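(* Let $\mathcal{F}$ be a family of (finite, simple) graphs and let $k=\min\{\chi(F) : F\in\mathcal{F}\}$, and suppose $k\geq 3$. In the Avoider-Enforcer game on $K_n$ for the properties $\mathcal{P}_n(\mathcal{F})$ and $\mathcal{P}_n^{\rm ind}(\mathcal{F})$, for $n$ large enough, we have $$ \left(\frac{k-2}{k-1}\right)\frac{n^2}{4}-O(k)=\left\lfloor\frac{1}{2}\, t(n,k-1)\right\rfloor\leq \tau_E(\mathcal{P}_n(\mathcal{F}))\leq\tau_E(\mathcal{P}_n^{\rm ind}(\mathcal{F}))\leq \left(\frac{k-2}{k-1}\right)\frac{n^2}{4}+o(n^2). $$ In addition, if $k=2$, then the last two inequalities hold, i.e. $\tau_E(\mathcal{P}_n(\mathcal{F}))\leq\tau_E(\mathcal{P}_n^{\rm ind}(\mathcal{F}))\leq \left(\frac{k-2}{k-1}\right)\frac{n^2}{4}+o(n^2)=o(n^2)$.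
   Context: Avoider-Enforcer game: two players, Avoider and Enforcer, alternately claim previously unclaimed edges of the complete graph $K_n$, one edge per turn; in each round each player claims exactly one edge, so after $r$ rounds each player has claimed exactly $r$ edges. Avoider's graph is the graph on the $n$ vertices of $K_n$ whose edges are those claimed by Avoider. Given a property $\mathcal{P}$ of graphs on $n$ vertices, Enforcer wants Avoider's graph to have property $\mathcal{P}$ as early as possible, and Avoider wants to prevent this for as many rounds as possible. $\tau_E(\mathcal{P})$ is the smallest integer $t$ such that Enforcer can win in $t$ rounds against any opponent, i.e. Enforcer has a strategy guaranteeing that Avoider's graph has property $\mathcal{P}$ within $t$ rounds. For a family $\mathcal{F}$ of graphs, $\mathcal{P}_n(\mathcal{F})$ is the property that a graph on $n$ vertices has a copy of some member of $\mathcal{F}$ as a (not necessarily induced) subgraph, and $\mathcal{P}_n^{\rm ind}(\mathcal{F})$ is the property that a graph on $n$ vertices has a copy of some member of $\mathcal{F}$ as an induced subgraph. $\chi(F)$ is the chromatic number of $F$. $t(n,k)$ is the Turán number: the maximum number of edges in a graph on $n$ vertices with no copy of $K_{k+1}$. Asymptotics: $\mathcal{F}$ (hence $k$) is fixed and $n\to\infty$; the bound with $o(n^2)$ means that for every $\delta>0$ there is $n_0$ such that for all $n\ge n_0$ the inequality holds with $o(n^2)$ replaced by $\delta n^2$. $O(k)$ denotes a quantity bounded in absolute value by an absolute constant times $k$. *)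

(* Defs.v *)
From mathcomp Require Import all_boot all_order all_algebra.
From mathcomp Require Import reals.

Set Implicit Arguments.
Unset Strict Implicit.
Unset Printing Implicit Defensive.

Record sgraph := SGraph {
  svertex :> finType;
  sedge : rel svertex;
  sedge_sym : symmetric sedge;
  sedge_irr : irreflexive sedge }.

Definition colorable (G : sgraph) (c : nat) : bool :=
  [exists f : {ffun G -> 'I_c}, [forall x, forall y, sedge x y ==> (f x != f y)]].

Lemma colorable_exists (G : sgraph) : exists c, colorable G c.
Proof.
exists #|G|; apply/existsP; exists [ffun x => enum_rank x].
apply/forallP => x; apply/forallP => y; apply/implyP => xy.
rewrite !ffunE; apply/eqP => /enum_rank_inj exy.
by rewrite exy sedge_irr in xy.
Qed.

Definition chi (G : sgraph) : nat := ex_minn (colorable_exists G).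

Definition has_copy (H G : sgraph) : bool :=
  [exists f : {ffun H -> G}, injectiveb f &&
     [forall x, forall y, sedge x y ==> sedge (f x) (f y)]].

Definition has_induced_copy (H G : sgraph) : bool :=
  [exists f : {ffun H -> G}, injectiveb f &&
     [forall x, forall y, sedge x y == sedge (f x) (f y)]].

Definition neq_rel (T : eqType) : rel T := fun x y => x != y.

Lemma neq_rel_sym (T : eqType) : symmetric (@neq_rel T).
Proof. by move=> x y; rewrite /neq_rel eq_sym. Qed.

Lemma neq_rel_irr (T : eqType) : irreflexive (@neq_rel T).
Proof. by move=> x; rewrite /neq_rel eqxx. Qed.

Definition complete_graph (m : nat) : sgraph :=
  SGraph (@neq_rel_sym 'I_m) (@neq_rel_irr 'I_m).

(* A graph on the n vertices of K_n is given by its set of edges. *)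
Definition K_edges (n : nat) : {set {set 'I_n}} := [set e : {set 'I_n} | #|e| == 2].

Definition adj n (E : {set {set 'I_n}}) : rel 'I_n :=
  fun x y => (x != y) && ([set x; y] \in E).

Lemma adj_sym n (E : {set {set 'I_n}}) : symmetric (adj E).
Proof. by move=> x y; rewrite /adj eq_sym setUC. Qed.

Lemma adj_irr n (E : {set {set 'I_n}}) : irreflexive (adj E).
Proof. by move=> x; rewrite /adj eqxx. Qed.

Definition graph_of n (E : {set {set 'I_n}}) : sgraph :=
  SGraph (@adj_sym n E) (@adj_irr n E).

Definition turan (n k : nat) : nat :=
  \max_(E : {set {set 'I_n}} |
      (E \subset K_edges n) && ~~ has_copy (complete_graph k.+1) (graph_of E))
    #|E|.

(* A family may be infinite. *)
Definition graph_family := sgraph -> Prop.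

Definition min_chromatic (F : graph_family) (k : nat) : Prop :=
  (exists2 G, F G & chi G = k) /\ (forall G, F G -> k <= chi G).

Definition graph_property (n : nat) := {set {set 'I_n}} -> Prop.

Definition contains (F : graph_family) n : graph_property n :=
  fun E => exists2 H, F H & has_copy H (graph_of E).

Definition contains_induced (F : graph_family) n : graph_property n :=
  fun E => exists2 H, F H & has_induced_copy H (graph_of E).

Arguments contains F n E : clear implicits.
Arguments contains_induced F n E : clear implicits.

(* A play is the sequence of all the edges claimed so far, by both players, in
   order. The boolean af tells whether Avoider makes the first move. *)
Definition legal_play n (s : seq {set 'I_n}) : bool :=
  uniq s && all (mem (K_edges n)) s.

Definition avoider_turn (af : bool) (i : nat) : bool := af (+) odd i.

Definition avoider_edges (af : bool) n (s : seq {set 'I_n}) : {set {set 'I_n}} :=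
  [set e in s | avoider_turn af (index e s)].

Definition strategy (n : nat) := seq {set 'I_n} -> {set 'I_n}.

Definition enforcer_strategy (af : bool) n (sigma : strategy n) : Prop :=
  forall s, legal_play s -> size s < #|K_edges n| ->
    ~~ avoider_turn af (size s) -> legal_play (rcons s (sigma s)).

Definition follows (af : bool) n (sigma : strategy n) (s : seq {set 'I_n}) : Prop :=
  forall i, i < size s -> ~~ avoider_turn af i ->
    nth set0 s i = sigma (take i s).

(* Play stops when all the edges are claimed, whence the minimum: a play of t
   rounds has 2t moves as long as there are that many edges. For a property
   that is not monotone, it is enough to have it at some point of the play. *)
Definition enforcer_wins_within (af : bool) n (P : graph_property n) (t : nat) : Prop :=
  exists2 sigma : strategy n, enforcer_strategy af sigma &
    forall s, legal_play s -> follows af sigma s ->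
      size s = minn t.*2 #|K_edges n| ->
      exists2 i, i <= size s & P (avoider_edges af (take i s)).

(* tau_E is a relation since it is undefined when Enforcer cannot win. *)
Definition is_tauE (af : bool) n (P : graph_property n) (t : nat) : Prop :=
  enforcer_wins_within af P t /\
  forall t', enforcer_wins_within af P t' -> t <= t'.

(* Main.v *)
Require Import Defs.
From mathcomp Require Import all_boot all_order all_algebra.
From mathcomp Require Import zify ring lra.
From mathcomp Require Import reals boolp.
Set Implicit Arguments.
Unset Strict Implicit.
Unset Printing Implicit Defensive.
Import Order.TTheory GRing.Theory Num.Theory.
Local Open Scope ring_scope.

(** Write r = k - 1.

    Lower bound: a K_k-free graph has at most as many edges as some complete
    r-partite graph ([clique_free_le_multipartite], proved by degree
    majorization), and complete r-partite graphs are K_k-free, so some complete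
    r-partite graph has turan n r edges ([turan_multipartite],
    [multipartite_le_turan]). As long as at most turan n r edges have been
    claimed in all, Avoider can play inside this graph
    ([avoider_stays_inside]); his graph is then r-colourable and contains no
    member of the family. The size of balanced complete r-partite graphs gives
    the numerical estimate ([half_turan_estimate]).

    Upper bound: let H be a member of the family of chromatic number k. By an
    exponential potential function, Enforcer can keep the two players balanced
    on every cut when n is large: with x = 1 on the edges of Avoider, -1 on those of Enforcer
    and 0 elsewhere, the sum of x over A * B is at most eps * n ^ 2 in absolute
    value for all vertex sets A and B ([enforcer_balances]). When a little more
    than (1 - 1 / r) * n ^ 2 / 2 edges have been claimed, the graph G of claimed
    edges contains a positive proportion of all homomorphic copies of the
    complete k-partite graph on the vertices of H
    ([multipartite_supersaturation]): sampling a bounded number of vertices and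
    applying the Turan bound gives a positive density of K_k, and the
    Cauchy-Schwarz inequality lets one duplicate vertices. Now map H to the n
    vertices at random. The indicator that an edge belongs to Avoider is
    (G + x) / 2, and a function x that is small on cuts may be dropped, factor
    by factor, from the mean of a product over the pairs of vertices of H
    ([hybrid]). So the probability that the map is an induced copy of H in
    Avoider's graph is up to a small error the mean of a product of factors
    G / 2 (for the edges of H) and 1 - G / 2 (for the other pairs). This is at
    least a constant times the density of copies of the complete k-partite
    graph, since the pairs inside a colour class are never edges of H
    ([induced_copy_of_density]). *)

(** * Cliques, colourings and the Turan bound *)

(** Erdos's form of the Turan theorem, by induction on r: split S into the
    neighbourhood of a vertex of maximum degree, which is coloured by induction,
    and the rest, which becomes one colour class. *)
Lemma degree_majorization (V : finType) (G : rel V) (r : nat) (S : {set V}) :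
  symmetric G ->
  (forall s : seq V, size s = r.+1 -> all (mem S) s -> ~~ pairwise G s) ->
  exists2 c : V -> nat, (forall x, x \in S -> (c x < r)%N) &
    forall u, u \in S ->
      (#|[set w in S | G u w]| <= #|[set w in S | c u != c w]|)%N.
Proof.
move=> Gsym; elim: r S => [|r IHr] S noclique.
  exists (fun=> 0%N) => x xS; by have := noclique [:: x] erefl; rewrite /= xS => /(_ isT).
have [->|/set0Pn[v0 v0S]] := eqVneq S set0; first by exists (fun=> 0%N) => x; rewrite inE.
pose deg u := #|[set w in S | G u w]|.
have [v vS vmax] : exists2 v, v \in S & forall u, u \in S -> (deg u <= deg v)%N.
  by case: (arg_maxnP deg v0S) => v vS vmax; exists v.
pose S' := [set w in S | G v w].
have [|c' c'r c'deg] := IHr S'.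
  move=> s ss /allP sS'; have := noclique (v :: s) (congr1 succn ss).
  rewrite pairwise_cons /= vS (_ : all (mem S) s) => [/(_ isT)|]; last first.
    by apply/allP => x /sS' /=; rewrite inE => /andP[].
  rewrite (_ : all (G v) s) //.
  by apply/allP => x /sS' /=; rewrite inE => /andP[].
have S'S : S' \subset S by apply/subsetP => x; rewrite inE => /andP[].
exists (fun x => if x \in S' then c' x else r) => [x xS|u uS].
  by case: ifP => // xS'; rewrite ltnS ltnW // c'r.
case: ifP => uS'; last first.
  (* outside the neighbourhood of v, the new degree is the maximum degree *)
  apply: leq_trans (vmax u uS) _; apply: subset_leq_card.
  apply/subsetP => w wS'; rewrite inE (subsetP S'S _ wS') /=.
  have -> : (w \in S') by [].
  by rewrite neq_ltn c'r ?orbT.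
have splitS (P : pred V) : #|[set w in S | P w]| =
    (#|[set w in S' | P w]| + #|[set w in S :\: S' | P w]|)%N.
  rewrite -cardsUI [X in (_ + X)%N](_ : _ = 0%N) ?addn0; last first.
    by apply/eqP; rewrite cards_eq0; apply/eqP/setP => w; rewrite !inE;
      case: (w \in S); case: (G v w); rewrite ?andbF.
  by apply: eq_card => w; rewrite !inE; case: (w \in S); case: (G v w); case: (P w).
rewrite !splitS; apply: leq_add.
  apply: leq_trans (c'deg u uS') _; apply: subset_leq_card.
  by apply/subsetP => w; rewrite !inE => /andP[/andP[-> ->]].
apply: subset_leq_card; apply/subsetP => w; rewrite inE => /andP[wD _].
have /setDP[wS wS'] := wD.
by rewrite inE wD /= (negPf wS') neq_ltn c'r.
Qed.

(** The edges of G, each counted in both orientations. *)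
Definition ordered_edges (V : finType) (G : rel V) := [set p : V * V | G p.1 p.2].

Lemma card_ordered_edges (V : finType) (G : rel V) :
  #|ordered_edges G| = (\sum_u #|[set w | G u w]|)%N.
Proof.
rewrite -sum1_card (eq_bigl (fun p => true && G p.1 p.2)) => [|p]; last by rewrite inE.
rewrite -(pair_big_dep xpredT (fun u w => G u w) (fun _ _ => 1%N)) /=.
by apply: eq_bigr => u _; rewrite -sum1_card; apply: eq_bigl => w; rewrite inE.
Qed.

(** A graph without K_{r+1} has at most as many edges as the complete multipartite
    graph of some colouring with r colours. Cliques are listed as sequences. *)
Lemma clique_free_le_multipartite (V : finType) (G : rel V) (r : nat) :
  symmetric G ->
  (forall s : seq V, size s = r.+1 -> ~~ pairwise G s) ->
  exists2 c : V -> nat, (forall x, (c x < r)%N) &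
    (#|ordered_edges G| <= #|ordered_edges (fun u w => c u != c w)|)%N.
Proof.
move=> Gsym noclique.
have [|c cr cdeg] := @degree_majorization V G r setT Gsym.
  by move=> s ss _; exact: noclique.
exists c => [x|]; first exact: cr.
rewrite !card_ordered_edges; apply: leq_sum => u _.
have := cdeg u (in_setT u); rewrite (_ : [set w in setT | G u w] = [set w | G u w]).
  by rewrite (_ : [set w in setT | _] = [set w | c u != c w]) //; apply/setP => w; rewrite !inE.
by apply/setP => w; rewrite !inE.
Qed.

Lemma card_bichromatic (V : finType) (c : V -> nat) (r : nat) :
  (forall x, (c x < r)%N) ->
  (#|ordered_edges (fun u w => c u != c w)| +
   \sum_(i < r) #|[set x | c x == i]| ^ 2 = #|V| ^ 2)%N.
Proof.
move=> cr.
have -> : (\sum_(i < r) #|[set x | c x == i]| ^ 2)%N =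
    #|ordered_edges (fun u w => c u == c w)|.
  rewrite -sum1_card (partition_big (fun p => Ordinal (cr p.1)) xpredT) //=.
  apply: eq_bigr => i _; rewrite -mulnn -cardsX -sum1_card.
  apply: eq_bigl => -[u w]; rewrite !inE /= -val_eqE /=.
  by rewrite andbC; apply/andP/andP => -[/eqP -> /eqP ->].
rewrite -[(#|V| ^ 2)%N]mulnn -card_prod -(cardsC (ordered_edges (fun u w => c u != c w))).
by congr (_ + _)%N; apply: eq_card => p; rewrite !inE negbK.
Qed.

Lemma sum_color_class (V : finType) (c : V -> nat) (r : nat) :
  (forall x, (c x < r)%N) -> (\sum_(i < r) #|[set x | c x == i]| = #|V|)%N.
Proof.
move=> cr; rewrite -sum1_card (partition_big (fun x => Ordinal (cr x)) xpredT) //=.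
apply: eq_bigr => i _; rewrite -sum1_card.
by apply: eq_bigl => x; rewrite inE -val_eqE.
Qed.

Lemma sqr_sum_leq (r : nat) (a : 'I_r -> nat) :
  ((\sum_i a i) ^ 2 <= r * \sum_i a i ^ 2)%N.
Proof.
rewrite -(leq_pmul2l (isT : 0 < 2)%N) -mulnn.
have -> : (2 * ((\sum_i a i) * (\sum_i a i)) = \sum_i \sum_j 2 * (a i * a j))%N.
  rewrite big_distrl big_distrr; apply: eq_bigr => i _.
  by rewrite !big_distrr.
have -> : (2 * (r * \sum_i a i ^ 2) = \sum_(i < r) \sum_(j < r) (a i ^ 2 + a j ^ 2))%N.
  under [RHS]eq_bigr do rewrite big_split /= sum_nat_const card_ord.
  by rewrite big_split /= sum_nat_const card_ord -big_distrr mul2n -addnn.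
by apply: leq_sum => i _; apply: leq_sum => j _; exact: nat_Cauchy.
Qed.

Lemma multipartite_le (V : finType) (c : V -> nat) (r : nat) :
  (forall x, (c x < r)%N) ->
  (r * #|ordered_edges (fun u w => c u != c w)| + #|V| ^ 2 <= r * #|V| ^ 2)%N.
Proof.
move=> cr; have := card_bichromatic cr.
have := @sqr_sum_leq r (fun i => #|[set x | c x == i]|).
rewrite (sum_color_class cr).
set Q := (\sum_i _)%N; set E := #|ordered_edges _|; set N := (_ ^ 2)%N.
by move=> h e; rewrite -{2}e mulnDr leq_add2l.
Qed.

(** Turan bound without error term: the number of ordered edges of a graph
    without K_{r+1} is at most (1 - 1 / r) |V|^2. *)
Lemma turan_dichotomy (V : finType) (G : rel V) (r : nat) : symmetric G ->
  (exists2 s : seq V, size s = r.+1 & pairwise G s) \/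
  (r * #|ordered_edges G| + #|V| ^ 2 <= r * #|V| ^ 2)%N.
Proof.
move=> Gsym.
case: (pselect (exists2 s : seq V, size s = r.+1 & pairwise G s)) => [|no]; [by left|right].
have [|c cr le_c] := @clique_free_le_multipartite V G r Gsym.
  by move=> s ss; apply/negP => sp; apply: no; exists s.
apply: leq_trans (multipartite_le cr).
by rewrite leq_add2r leq_mul2l le_c orbT.
Qed.

Lemma card_modn_class (n r i : nat) : (i < r)%N ->
  (n %/ r <= #|[set x : 'I_n | x %% r == i]| <= (n %/ r).+1)%N.
Proof.
move=> ir; have r0 : (0 < r)%N by lia.
apply/andP; split.
  have lt_n (j : 'I_(n %/ r)) : (j * r + i < n)%N.
    have := ltn_ord j; have := leq_divM n r; nia.
  rewrite -[X in (X <= _)%N]card_ord.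
  rewrite -(@card_imset _ _ (fun j : 'I_(n %/ r) => Ordinal (lt_n j))).
    apply: subset_leq_card; apply/subsetP => _ /imsetP[j _ ->].
    by rewrite inE /= modnMDl modn_small.
  move=> j j' /(congr1 val) /= /eqP; rewrite eqn_add2r eqn_pmul2r //.
  by move/eqP/val_inj.
rewrite -[X in (_ <= X)%N]card_ord.
have lt_n (x : 'I_n) : (x %/ r < (n %/ r).+1)%N.
  by rewrite ltnS leq_div2r // ltnW.
rewrite -(@card_in_imset _ _ (fun x : 'I_n => Ordinal (lt_n x))) ?max_card //.
move=> x y; rewrite !inE => /eqP xi /eqP yi /(congr1 val) /= e.
by apply: val_inj; rewrite /= (divn_eq x r) (divn_eq y r) e xi yi.
Qed.

(** The classes of the colouring by residues modulo r have size q or q + 1, where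
    q = n %/ r, so the sum of the squares of their sizes is (2 q + 1) n - r q (q + 1). *)
Lemma balanced_multipartite_ge (n r : nat) : (0 < r)%N ->
  (r * n ^ 2 <= r * #|ordered_edges (fun u w : 'I_n => u %% r != w %% r)%N|
                + n ^ 2 + r ^ 2)%N.
Proof.
move=> r0; pose c (x : 'I_n) := (x %% r)%N.
have cr x : (c x < r)%N by rewrite ltn_mod.
have := card_bichromatic cr; rewrite card_ord -/c.
set E := #|_|; set Q := (\sum_(i < r) _)%N => EQ.
pose q := (n %/ r)%N; pose s := (n %% r)%N.
have n_eq : n = (q * r + s)%N by exact: divn_eq.
have s_lt : (s < r)%N by rewrite ltn_mod.
have sumsq : (Q + r * (q * q.+1) =
              (2 * q + 1) * n)%N.
  have := sum_color_class cr; rewrite card_ord => <-; rewrite big_distrr /=.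
  rewrite -[X in (_ + X * _)%N]card_ord -sum_nat_const -big_split /=.
  apply: eq_bigr => i _.
  (* a ^ 2 + q (q + 1) = (2 q + 1) a when a is q or q + 1 *)
  have := card_modn_class n (ltn_ord i); rewrite -/q -/c.
  set a := #|_| => /andP[a1 a2].
  have [->|->] : a = q \/ a = q.+1 by lia.
    by lia.
  by lia.
suff h : (r * Q <= n ^ 2 + r ^ 2)%N.
  have e : (r * n ^ 2 = r * E + r * Q)%N by rewrite -mulnDr EQ.
  by rewrite e -addnA leq_add2l.
(* with n = q r + s, one has r Q = n ^ 2 + s (r - s) *)
have rs : (r * s <= r ^ 2)%N by rewrite -mulnn leq_mul // ltnW.
have e : (r * Q + r * (r * (q * q.+1)) = r * ((2 * q + 1) * n))%N.
  by rewrite -sumsq mulnDr.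
have : (r * ((2 * q + 1) * n) + s * s = n ^ 2 + r * s + r * (r * (q * q.+1)))%N.
  by rewrite n_eq; ring.
lia.
Qed.

(** * Means over finite types *)

(** The mean of F over the uniform distribution on I; it is 0 when I is empty. *)
Definition mean (R : realFieldType) (I : finType) (F : I -> R) : R :=
  (\sum_i F i) / #|I|%:R.

Section Mean.
Variables (R : realFieldType) (I : finType).
Implicit Types F : I -> R.

Lemma eq_mean F1 F2 : F1 =1 F2 -> mean F1 = mean F2.
Proof. by move=> e; rewrite /mean (eq_bigr F2). Qed.

Lemma ler_mean F1 F2 : (forall i, F1 i <= F2 i) -> mean F1 <= mean F2.
Proof. by move=> h; rewrite ler_wpM2r ?invr_ge0 ?ler0n // ler_sum. Qed.

Lemma meanD F1 F2 : mean (fun i => F1 i + F2 i) = mean F1 + mean F2.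
Proof. by rewrite /mean big_split mulrDl. Qed.

Lemma meanZ a F : mean (fun i => a * F i) = a * mean F.
Proof. by rewrite /mean -big_distrr mulrA. Qed.

Lemma meanB F1 F2 : mean (fun i => F1 i - F2 i) = mean F1 - mean F2.
Proof. by rewrite /mean sumrB mulrBl. Qed.

Lemma mean_sum (J : finType) (P : pred J) (F : J -> I -> R) :
  mean (fun i => \sum_(j | P j) F j i) = \sum_(j | P j) mean (F j).
Proof. by rewrite /mean exchange_big -big_distrl. Qed.

Lemma mean_cst a : (0 < #|I|)%N -> mean (fun _ : I => a) = a :> R.
Proof.
move=> I0; rewrite /mean sumr_const -[a *+ _]mulr_natr mulfK //.
by rewrite pnatr_eq0 -lt0n.
Qed.

Lemma mean_ge0 F : (forall i, 0 <= F i) -> 0 <= mean F.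
Proof. by move=> h; rewrite divr_ge0 ?ler0n ?sumr_ge0. Qed.

Lemma mean_gt0_witness F : 0 < mean F -> exists i, 0 < F i.
Proof.
move=> h; case: (pickP (fun i => 0 < F i)) => [i|no]; first by exists i.
exfalso; move: h; rewrite ltNge => /negP; apply.
rewrite mulr_le0_ge0 ?invr_ge0 ?ler0n //.
by apply: sumr_le0 => i _; rewrite leNgt no.
Qed.

Lemma ler_norm_mean F a :
  (0 < #|I|)%N -> (forall i, `|F i| <= a) -> `|mean F| <= a.
Proof.
move=> I0 h; rewrite -(mean_cst a I0) ler_norml.
have -> : - mean (fun _ : I => a) = mean (fun _ : I => - a).
  by rewrite !mean_cst.
by apply/andP; split; apply: ler_mean => i; have := h i; rewrite ler_norml => /andP[].
Qed.

(** The Cauchy-Schwarz inequality against the constant function 1. *)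
Lemma sqr_mean_le F : mean F ^+ 2 <= mean (fun i => F i ^+ 2).
Proof.
case: (posnP #|I|) => [I0|I0].
  by rewrite /mean I0 invr0 !mulr0 expr0n.
rewrite -subr_ge0.
have -> : mean (fun i => F i ^+ 2) - mean F ^+ 2 = mean (fun i => (F i - mean F) ^+ 2).
  rewrite [RHS](eq_mean (F2 := fun i => F i ^+ 2 + ((- 2 * mean F) * F i + mean F ^+ 2))); last first.
    by move=> i /=; ring.
  by rewrite meanD meanD meanZ mean_cst //; ring.
by apply: mean_ge0 => i; exact: sqr_ge0.
Qed.

End Mean.

(** * Random maps, resampled one coordinate at a time *)

(** The map f with its value at i replaced by z. *)
Definition upd (T V : finType) (f : {ffun T -> V}) (i : T) (z : V) : {ffun T -> V} :=
  [ffun j => if j == i then z else f j].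

Section Resampling.
Variables (R : realFieldType) (T V : finType).
Hypothesis V0 : (0 < #|V|)%N.
Implicit Types (F : {ffun T -> V} -> R) (f : {ffun T -> V}).

Lemma ffun_gt0 : (0 < #|{ffun T -> V}|)%N.
Proof. by rewrite card_ffun expn_gt0 V0. Qed.

Lemma updE f i z j : upd f i z j = if j == i then z else f j.
Proof. by rewrite ffunE. Qed.

Lemma upd_same f i z : upd f i z i = z.
Proof. by rewrite updE eqxx. Qed.

Lemma upd_other f i z j : j != i -> upd f i z j = f j.
Proof. by rewrite updE => /negPf ->. Qed.

Lemma updC f i j y z : i != j -> upd (upd f i y) j z = upd (upd f j z) i y.
Proof.
move=> ij; apply/ffunP => l; rewrite !updE.
by case: (l =P j) => [->|//]; rewrite eq_sym (negPf ij).
Qed.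

Lemma upd_upd f i y z : upd (upd f i y) i z = upd f i z.
Proof. by apply/ffunP => l; rewrite !updE; case: (l == i). Qed.

(** Resampling one coordinate preserves the uniform distribution on maps: the
    exchange of z with f i is an involution of the pairs (f, z). *)
Lemma mean_upd F i : mean (fun f => mean (fun z => F (upd f i z))) = mean F.
Proof.
have V0' : (#|V|%:R : R) != 0 by rewrite pnatr_eq0 -lt0n.
rewrite /mean -big_distrl /=; congr (_ / _).
rewrite pair_big /=.
pose h (p : {ffun T -> V} * V) := (upd p.1 i p.2, p.1 i).
have hK : involutive h.
  move=> [f z]; rewrite /h /= upd_same; congr (_, _).
  by apply/ffunP => j; rewrite !updE; case: eqP => [->|].
rewrite (reindex_inj (inv_inj hK)) /=.
rewrite (eq_bigr (fun p => F p.1)); last first.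
  move=> [f z] _ /=; congr F.
  by apply/ffunP => j; rewrite !updE; case: eqP => [->|].
rewrite -(pair_big xpredT xpredT (fun f (_ : V) => F f)) /=.
rewrite (eq_bigr (fun f => F f * #|V|%:R)); last first.
  by move=> f _; rewrite sumr_const mulr_natr.
by rewrite -big_distrl /= mulfK.
Qed.

Lemma mean_upd2 F i j :
  mean (fun f => mean (fun a => mean (fun b => F (upd (upd f i a) j b)))) = mean F.
Proof. by rewrite (mean_upd (fun f => mean (fun b => F (upd f j b)))) mean_upd. Qed.

(** Duplication of the coordinate b by Cauchy-Schwarz: the second copy of b is the
    coordinate u, on which F does not depend. *)
Lemma sqr_mean_duplicate F u b : u != b ->
  (forall f z, F (upd f u z) = F f) ->
  mean F ^+ 2 <= mean (fun f => F f * F (upd f b (f u))).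
Proof.
move=> ub Fu; pose P f := mean (fun z => F (upd f b z)).
have -> : mean (fun f => F f * F (upd f b (f u))) = mean (fun f => F f * P f).
  rewrite -(mean_upd _ u); apply: eq_mean => f; rewrite -meanZ; apply: eq_mean => z.
  by rewrite upd_same Fu updC // Fu.
rewrite -(mean_upd (fun f => F f * P f) b).
have -> : mean (fun f => mean (fun z => F (upd f b z) * P (upd f b z))) =
          mean (fun f => P f ^+ 2).
  apply: eq_mean => f; rewrite expr2 {2}/P -meanZ; apply: eq_mean => z.
  by rewrite mulrC; congr (_ * _); apply: eq_mean => y; rewrite upd_upd.
by rewrite -(mean_upd F b) sqr_mean_le.
Qed.

End Resampling.

(** * Supersaturation of complete multipartite graphs *)

Section Supersaturation.
Variables (R : realFieldType) (V : finType) (G : rel V).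
Hypotheses (V0 : (0 < #|V|)%N) (Gsym : symmetric G) (Girr : irreflexive G).

(** The probability that a random pair of vertices is an edge. *)
Definition density : R := #|ordered_edges G|%:R / #|V|%:R ^+ 2.

Lemma mean_pair (T : finType) (i j : T) : i != j ->
  mean (fun f : {ffun T -> V} => (G (f i) (f j))%:R) = density.
Proof.
move=> ij; rewrite -(mean_upd2 V0 _ i j) /=.
rewrite (eq_mean (F2 := fun=> mean (fun a => mean (fun b => (G a b)%:R)))); last first.
  move=> f; apply: eq_mean => a; apply: eq_mean => b.
  by rewrite upd_same upd_other // upd_same.
rewrite mean_cst ?ffun_gt0 // /density /mean -big_distrl /= -mulrA -invfM -expr2.
congr (_ / _); rewrite pair_big /= -sum1_card natr_sum [RHS]big_mkcond /=.
by apply: eq_bigr => -[a b] _; rewrite inE /=; case: (G a b).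
Qed.

(** f is a homomorphism to G from the complete multipartite graph on S whose parts
    are the classes of the colouring col. *)
Definition proper_on (T : finType) (K : eqType) (col : T -> K) (S : {set T})
    (f : {ffun T -> V}) : bool :=
  [forall x in S, forall y in S, (col x != col y) ==> G (f x) (f y)].

Lemma proper_onP (T : finType) (K : eqType) (col : T -> K) (S : {set T}) (f : {ffun T -> V}) :
  reflect (forall x y, x \in S -> y \in S -> col x != col y -> G (f x) (f y))
    (proper_on col S f).
Proof.
apply: (iffP forall_inP) => [h x y xS yS xy|h x xS].
  by have /forall_inP/(_ y yS)/implyP/(_ xy) := h x xS.
by apply/forall_inP => y yS; apply/implyP; exact: h.
Qed.

(** Adding to S a twin u of one of its vertices b at most squares the density. *)
Lemma blowup_step (T : finType) (K : eqType) (col : T -> K) (S : {set T}) (u b : T) :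
  u \notin S -> b \in S -> col b = col u ->
  mean (fun f => (proper_on col S f)%:R : R) ^+ 2 <=
  mean (fun f => (proper_on col (u |: S) f)%:R).
Proof.
move=> uS bS bu; have ub : u != b by apply: contraNneq uS => ->.
apply: le_trans (sqr_mean_duplicate V0 ub _) _.
  move=> f z; congr (_%:R); congr nat_of_bool.
  apply/proper_onP/proper_onP => h x y xS yS xy; have := h x y xS yS xy;
    by rewrite !upd_other //; apply: contraNneq uS => <-.
apply: ler_mean => f; rewrite -natrM ler_nat mulnb.
case: (boolP (_ && _)) => // /andP[/proper_onP h1 /proper_onP h2].
suff -> : proper_on col (u |: S) f by [].
apply/proper_onP => x y.
have hu z : z \in S -> col u != col z -> G (f u) (f z).
  move=> zS uz; have := h2 b z bS zS; rewrite bu => /(_ uz).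
  by rewrite upd_same upd_other //; apply: contraNneq uz => ->; rewrite bu.
rewrite !in_setU1 => /orP[/eqP->|xS] /orP[/eqP->|yS]; first by rewrite eqxx.
- exact: hu.
- by rewrite eq_sym Gsym; exact: hu.
- exact: h1.
Qed.

(** Iteration of [blowup_step]: S has a vertex of each colour, and the vertices
    listed in l are added as twins. *)
Lemma blowup (T : finType) (K : eqType) (col : T -> K) (S : {set T}) (l : seq T) (d : R) :
  (forall u, exists2 b, b \in S & col b = col u) -> 0 <= d ->
  d <= mean (fun f => (proper_on col S f)%:R) ->
  d ^+ (2 ^ size l) <= mean (fun f => (proper_on col (S :|: [set:: l]) f)%:R).
Proof.
move=> full d0 dS.
have d1 : d <= 1.
  apply: le_trans dS _; rewrite -[X in _ <= X](@mean_cst R {ffun T -> V}) ?ffun_gt0 //.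
  by apply: ler_mean => f; rewrite lern1 leq_b1.
elim: l => [|u l IHl].
  by rewrite expn0 expr1 (_ : S :|: _ = S) //; apply/setP => x; rewrite !inE orbF.
have -> : S :|: [set:: u :: l] = u |: (S :|: [set:: l]).
  by apply/setP => x; rewrite !inE; case: (x == u); case: (x \in S).
have e : d ^+ (2 ^ size (u :: l)) = (d ^+ (2 ^ size l)) ^+ 2.
  by rewrite -exprM /= expnS mulnC.
have [uS|uS] := boolP (u \in S :|: [set:: l]).
  rewrite (setUidPr _) ?sub1set //; apply: le_trans IHl.
  by rewrite e expr2 ler_piMl ?exprn_ge0 // exprn_ile1.
have [b bS bu] := full u.
have bS' : b \in S :|: [set:: l] by rewrite inE bS.
apply: le_trans (blowup_step uS bS' bu); rewrite e.
by rewrite lerXn2r // nnegrE ?exprn_ge0 // mean_ge0.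
Qed.

(** A random m-tuple of vertices spans on average more than (1 - 1 / r) m^2
    ordered edges, hence contains K_{r+1} with probability at least delta / 2;
    some position g of the clique in the m-tuple is then frequent. *)
Lemma clique_supersaturation (T : finType) (m r : nat) (iota : 'I_m -> T) (delta : R) :
  injective iota -> (0 < r)%N -> (0 < m)%N -> 2 <= delta * m%:R ->
  1 - r%:R^-1 + delta <= density ->
  exists2 g : {ffun 'I_r.+1 -> 'I_m}, injective g &
    delta / 2 / (m ^ r.+1)%:R <=
    mean (fun f : {ffun T -> V} =>
      [forall i, forall j, (i != j) ==> G (f (iota (g i))) (f (iota (g j)))]%:R).
Proof.
move=> inj_iota r0 m0 dm dens.
pose K (g : {ffun 'I_r.+1 -> 'I_m}) (f : {ffun T -> V}) : R :=
  [forall i, forall j, (i != j) ==> G (f (iota (g i))) (f (iota (g j)))]%:R.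
have mR : 0 < m%:R :> R by rewrite ltr0n.
have rR : 0 < r%:R :> R by rewrite ltr0n.
have delta0 : 0 < delta by rewrite -(pmulr_lgt0 _ mR); apply: lt_le_trans dm.
have mr0 : 0 < (m ^ r.+1)%:R :> R by rewrite ltr0n expn_gt0 m0.
have sumK : delta / 2 <= \sum_g mean (K g).
  (* the mean number of ordered edges spanned by the sample, bounded by Turan *)
  pose pairs (f : {ffun T -> V}) :=
    #|ordered_edges (fun i j : 'I_m => G (f (iota i)) (f (iota j)))|.
  have pointwise f : (pairs f)%:R <= (1 - r%:R^-1) * m%:R ^+ 2 + m%:R ^+ 2 * \sum_g K g f.
    have sK0 : 0 <= \sum_g K g f by apply: sumr_ge0 => g _; rewrite ler0n.
    have [] := @turan_dichotomy _ (fun i j : 'I_m => G (f (iota i)) (f (iota j))) r.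
    - by move=> i j; rewrite Gsym.
    - move=> [s ss spw]; pose x0 := Ordinal m0.
      pose g := [ffun i : 'I_r.+1 => nth x0 s i].
      have Kg : K g f = 1.
        rewrite /K (_ : [forall i, _] = true) //.
        apply/forallP => i; apply/forallP => j; apply/implyP => ij; rewrite !ffunE.
        move/(pairwiseP x0): spw => spw.
        move: ij; rewrite -val_eqE neq_ltn => /orP[] ij; last rewrite Gsym;
          by apply: spw => //; rewrite inE ss ltn_ord.
      have : 1 <= \sum_g K g f.
        rewrite (bigD1 g) //= Kg lerDl; apply: sumr_ge0 => g' _; exact: ler0n.
      have : (pairs f)%:R <= m%:R ^+ 2 :> R.
        rewrite -natrX ler_nat -mulnn -[m]card_ord -card_prod; exact: max_card.
      have : r%:R^-1 <= 1 :> R by rewrite invf_le1 // ler1n.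
      by move=> *; nra.
    - rewrite card_ord -/(pairs f) => h.
      apply: (@le_trans _ _ ((1 - r%:R^-1) * m%:R ^+ 2)); last first.
        by rewrite lerDl mulr_ge0 // exprn_ge0 // ler0n.
      rewrite -(ler_pM2l rR) mulrA mulrBr mulr1 mulfV ?gt_eqF //.
      move: h; rewrite -(ler_nat R) natrD [X in _ <= X]natrM [X in X + _]natrM natrX => h.
      by rewrite mulrBl mul1r lerBrDr.
  have mean_pairs : mean (fun f => (pairs f)%:R) = (m%:R * (m%:R - 1)) * density.
    rewrite (eq_mean (F2 := fun f : {ffun T -> V} =>
       \sum_i \sum_(j | i != j) (G (f (iota i)) (f (iota j)))%:R)).
      rewrite mean_sum; under eq_bigr do rewrite mean_sum.
      under eq_bigr => i _ do under eq_bigr => j ij do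
        rewrite mean_pair ?(inj_eq inj_iota) //.
      rewrite (eq_bigr (fun=> density * (m%:R - 1))).
        by rewrite sumr_const card_ord -mulr_natl; ring.
      move=> i _; rewrite sumr_const -[_ *+ _]mulr_natr; congr (_ * _).
      have -> : #|(fun j => i != j)| = m.-1.
        rewrite -[m in RHS]card_ord -(cardC1 i).
        by apply: eq_card => j; rewrite !inE eq_sym.
      by rewrite -subn1 natrB.
    move=> f; rewrite /pairs -sum1_card natr_sum pair_big_dep /=.
    rewrite big_mkcond [RHS]big_mkcond /=.
    apply: eq_bigr => -[i j] _ /=; rewrite inE /=.
    by case: (i =P j) => [->|_] /=; rewrite ?Girr //; case: (G _ _).
  have dens1 : density <= 1.
    rewrite /density ler_pdivrMr ?exprn_gt0 ?ltr0n // mul1r -natrX ler_nat.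
    rewrite -mulnn -card_prod; exact: max_card.
  have : m%:R * (m%:R - 1) * density <=
         (1 - r%:R^-1) * m%:R ^+ 2 + m%:R ^+ 2 * \sum_g mean (K g).
    rewrite -mean_pairs; apply: le_trans (ler_mean pointwise) _.
    by rewrite meanD mean_cst ?ffun_gt0 // meanZ mean_sum.
  set Sg := \sum_g _ => h.
  have h1 : (density * m%:R - density) * m%:R <= ((1 - r%:R^-1 + Sg) * m%:R) * m%:R.
    have -> : (density * m%:R - density) * m%:R = m%:R * (m%:R - 1) * density by ring.
    apply: le_trans h _; rewrite [X in X <= _](_ : _ = (1 - r%:R^-1 + Sg) * m%:R * m%:R) //.
    by set q := r%:R^-1; ring.
  move: h1; rewrite ler_pM2r // => h1.
  rewrite -(ler_pM2r mR).
  have := ler_wpM2r (ltW mR) dens; move: h1; set q := r%:R^-1 => h1 h2; nra.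
have [g Kg] : exists g, delta / 2 / (m ^ r.+1)%:R <= mean (K g).
  case: (pickP (fun g => delta / 2 / (m ^ r.+1)%:R <= mean (K g))) => [g|no]; first by exists g.
  exfalso; move: sumK; rewrite leNgt => /negP; apply.
  have -> : delta / 2 = \sum_(g : {ffun 'I_r.+1 -> 'I_m}) delta / 2 / (m ^ r.+1)%:R.
    rewrite sumr_const card_ffun !card_ord -[RHS]mulr_natr divfK //.
    by rewrite gt_eqF.
  apply: ltr_sum => [|g _]; last by rewrite ltNge no.
  by apply/hasP; exists [ffun=> Ordinal m0] => //; rewrite mem_index_enum.
(* a clique has distinct vertices and its frequency is positive *)
exists g => //.
have : 0 < mean (K g) by apply: lt_le_trans Kg; rewrite !divr_gt0.
move=> /mean_gt0_witness[f]; rewrite /K; case: forallP => [h _|]; last by rewrite ltxx.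
move=> i j gij; apply/eqP/negPn/negP => ij.
by have /forallP/(_ j)/implyP/(_ ij) := h i; rewrite gij Girr.
Qed.

(** A graph of density at least 1 - 1 / r + delta contains a positive proportion,
    independent of |V|, of all the homomorphic copies of any complete
    (r+1)-partite graph. The m extra coordinates hold the sample in which a
    clique is found; the vertices of H are twins of those of the clique. *)
Lemma multipartite_supersaturation (H : finType) (r m : nat) (col : H -> 'I_r.+1) (delta : R) :
  (0 < r)%N -> (0 < m)%N -> 2 <= delta * m%:R ->
  1 - r%:R^-1 + delta <= density ->
  (delta / 2 / (m ^ r.+1)%:R) ^+ (2 ^ #|H|) <=
  mean (fun f : {ffun 'I_m + H -> V} =>
    [forall u, forall w, (col u != col w) ==> G (f (inr u)) (f (inr w))]%:R).
Proof.
move=> r0 m0 dm dens.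
have [|g g_inj Kg] := @clique_supersaturation ('I_m + H)%type m r inl delta _ r0 m0 dm dens.
  by move=> i j [].
(* the sampled vertices outside of the clique receive an irrelevant colour *)
pose colT (x : 'I_m + H) : 'I_r.+1 :=
  match x with inl i => odflt ord0 [pick c | g c == i] | inr u => col u end.
have colg c : colT (inl (g c)) = c.
  by rewrite /=; case: pickP => [c' /eqP/g_inj|/(_ c)]; rewrite ?eqxx.
pose S := [set (inl (g c) : 'I_m + H) | c : 'I_r.+1].
have mR : 0 < m%:R :> R by rewrite ltr0n.
have delta0 : 0 < delta by rewrite -(pmulr_lgt0 _ mR); apply: lt_le_trans dm.
have := @blowup _ _ colT S [seq inr u | u <- enum H] (delta / 2 / (m ^ r.+1)%:R).
rewrite size_map -cardE => h; apply: le_trans (h _ _ _) _.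
- by move=> u; exists (inl (g (colT u))); rewrite ?colg //; apply/imsetP; exists (colT u).
- by rewrite divr_ge0 ?ler0n // divr_ge0 ?ler0n // ltW.
- apply: le_trans Kg _; apply: ler_mean => f; rewrite ler_nat.
  case: forallP => // h'; suff -> : proper_on colT S f by [].
  apply/proper_onP => _ _ /imsetP[i _ ->] /imsetP[j _ ->]; rewrite !colg => ij.
  by have /forallP/(_ j)/implyP/(_ ij) := h' i.
- apply: ler_mean => f; rewrite ler_nat; case: proper_onP => // h'.
  rewrite (_ : [forall u, _] = true) //.
  apply/forallP => u; apply/forallP => w; apply/implyP => uw.
  by apply: h' => //; rewrite !inE; apply/orP; right; apply: map_f; rewrite mem_enum.
Qed.

End Supersaturation.

(** * Functions small on cuts, and counting induced copies *)

Lemma indicator_bounds (R : realFieldType) (b : bool) : 0 <= (b%:R : R) <= 1.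
Proof. by rewrite ler0n lern1 leq_b1. Qed.

Lemma complement_bounds (R : realFieldType) (x : R) : 0 <= x <= 1 -> 0 <= 1 - x <= 1.
Proof. by move=> /andP[x0 x1]; rewrite subr_ge0 x1 gerBl. Qed.

Lemma half_bounds (R : realFieldType) (x : R) : 0 <= x <= 1 -> 0 <= x / 2 <= 1.
Proof. by move=> /andP[x0 x1]; apply/andP; split; lra. Qed.

Section CutNorm.
Variables (R : realFieldType) (V : finType).
Implicit Types (x : V -> V -> R).

(** x has small cut norm: its sum over any rectangle is at most eps |V|^2. *)
Definition cut_bounded x (eps : R) :=
  forall A B : {set V}, `|\sum_(a in A) \sum_(b in B) x a b| <= eps * #|V|%:R ^+ 2.

(** A linear form on the cube [0, 1]^V is maximal at a vertex of the cube. *)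
Lemma weighted_sum_le (alpha y : V -> R) : (forall a, 0 <= alpha a <= 1) ->
  \sum_a alpha a * y a <= \sum_(a in [set a | 0 < y a]) y a.
Proof.
move=> a01; rewrite [X in _ <= X]big_mkcond; apply: ler_sum => a _; rewrite inE.
have /andP[a0 a1] := a01 a; case: ltP => y0; first by rewrite ler_piMl // ltW.
by rewrite mulr_ge0_le0.
Qed.

Lemma cut_weights_le x (K : R) (alpha beta : V -> R) :
  (forall A B : {set V}, \sum_(a in A) \sum_(b in B) x a b <= K) ->
  (forall a, 0 <= alpha a <= 1) -> (forall b, 0 <= beta b <= 1) ->
  \sum_a \sum_b alpha a * beta b * x a b <= K.
Proof.
move=> cut a01 b01.
have -> : \sum_a \sum_b alpha a * beta b * x a b = \sum_a alpha a * \sum_b beta b * x a b.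
  by apply: eq_bigr => a _; rewrite big_distrr /=; apply: eq_bigr => b _; rewrite mulrA.
apply: le_trans (weighted_sum_le _ a01) _; rewrite exchange_big /=.
under eq_bigr do rewrite -big_distrr /=.
apply: le_trans (weighted_sum_le _ b01) _; rewrite exchange_big /=; exact: cut.
Qed.

(** The rectangles in [cut_bounded] may be replaced by products of weights in
    [0, 1]. *)
Lemma cut_weights x (eps : R) (alpha beta : V -> R) :
  (0 < #|V|)%N -> cut_bounded x eps ->
  (forall a, 0 <= alpha a <= 1) -> (forall b, 0 <= beta b <= 1) ->
  `|mean (fun a => mean (fun b => alpha a * beta b * x a b))| <= eps.
Proof.
move=> V0 cut a01 b01.
have V0' : 0 < #|V|%:R ^+ 2 :> R by rewrite exprn_gt0 ?ltr0n.
rewrite /mean -big_distrl /= -mulrA -invfM -expr2.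
rewrite normrM normfV (gtr0_norm V0') ler_pdivrMr //.
rewrite ler_norml; apply/andP; split.
  rewrite lerNl -sumrN; under eq_bigr do rewrite -sumrN.
  under eq_bigr do under eq_bigr do rewrite -mulrN.
  apply: (cut_weights_le (x := fun a b => - x a b)) => // A B.
  have := cut A B; rewrite ler_norml => /andP[h _].
  rewrite -[X in _ <= X]opprK lerNr -sumrN.
  by under eq_bigr do rewrite -sumrN; under eq_bigr do under eq_bigr do rewrite opprK.
apply: cut_weights_le => // A B.
by have := cut A B; rewrite ler_norml => /andP[].
Qed.

Lemma cut_boundedZ x (eps a : R) :
  `|a| <= 1 -> cut_bounded x eps -> cut_bounded (fun u v => a * x u v) eps.
Proof.
move=> a1 cut A B; under eq_bigr do rewrite -big_distrr /=.
rewrite -big_distrr normrM; apply: le_trans (cut A B).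
by rewrite ler_piMl.
Qed.

End CutNorm.

Section Counting.
Variables (R : realFieldType) (T V : finType).
Hypothesis V0 : (0 < #|V|)%N.

(** A factor of small cut norm at the coordinates u and w makes the mean small,
    provided that no other factor depends on both u and w. *)
Lemma cut_pair x (eps : R) (u w : T) (Q1 Q2 : {ffun T -> V} -> R) : u != w ->
  cut_bounded x eps ->
  (forall f z, Q1 (upd f w z) = Q1 f) -> (forall f z, Q2 (upd f u z) = Q2 f) ->
  (forall f, 0 <= Q1 f <= 1) -> (forall f, 0 <= Q2 f <= 1) ->
  `|mean (fun f : {ffun T -> V} => Q1 f * Q2 f * x (f u) (f w))| <= eps.
Proof.
move=> uw cut Q1w Q2u Q1b Q2b; rewrite -(mean_upd2 V0 _ u w) /=.
apply: ler_norm_mean; first exact: ffun_gt0.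
move=> f.
rewrite (eq_mean (F2 := fun a => mean (fun b => Q1 (upd f u a) * Q2 (upd f w b) * x a b))).
  by apply: cut_weights.
move=> a; apply: eq_mean => b.
by rewrite Q1w (updC _ _ _ uw) Q2u upd_same -(updC _ _ _ uw) upd_same.
Qed.

(** P is a set of pairs of coordinates in which no unordered pair occurs twice. In
    a product over P of factors in [0, 1], the factors z are replaced by the
    factors y one at a time; each replacement costs at most eps. *)
Variables (P : {set T * T}) (y z : T * T -> V -> V -> R) (eps : R).
Hypothesis P_neq : forall p, p \in P -> p.1 != p.2.
Hypothesis P_simple : forall p q, p \in P -> q \in P -> q != p ->
  (q.1 == p.2) || (q.2 == p.2) -> (q.1 != p.1) && (q.2 != p.1).
Hypotheses (y01 : forall p a b, 0 <= y p a b <= 1) (z01 : forall p a b, 0 <= z p a b <= 1).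
Hypothesis cut : forall p, cut_bounded (fun a b => z p a b - y p a b) eps.

(* in t S, the factors on S have been replaced *)
Let t (S : {set T * T}) p := if p \in S then y p else z p.
Let D S := mean (fun f : {ffun T -> V} => \prod_(p in P) t S p (f p.1) (f p.2)).

Lemma prod01 (I : finType) (Q : pred I) (F : I -> R) :
  (forall i, 0 <= F i <= 1) -> 0 <= \prod_(i | Q i) F i <= 1.
Proof.
move=> h; rewrite prodr_ge0 => [|i _]; last by have /andP[] := h i.
by rewrite prodr_ile1 // => i.
Qed.

Lemma hybrid_step (S : {set T * T}) p : p \in P -> p \notin S -> D S <= D (p |: S) + eps.
Proof.
move=> pP pS; rewrite -lerBlDl -meanB.
have t01 S' q a b : 0 <= t S' q a b <= 1 by rewrite /t; case: ifP.
(* Q1 collects the factors free of p.2; those of Q2 involve p.2, hence not p.1 *)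
pose Q1 (f : {ffun T -> V}) := \prod_(q in P | (q != p) && ~~ ((q.1 == p.2) || (q.2 == p.2)))
  t S q (f q.1) (f q.2).
pose Q2 (f : {ffun T -> V}) := \prod_(q in P | (q != p) && ((q.1 == p.2) || (q.2 == p.2)))
  t S q (f q.1) (f q.2).
apply: le_trans (ler_norm _) _.
rewrite (eq_mean (F2 := fun f : {ffun T -> V} =>
    Q1 f * Q2 f * (fun a b => z p a b - y p a b) (f p.1) (f p.2))).
  apply: (cut_pair (P_neq pP) (@cut p)) => [f v|f v|f|f].
  - apply: eq_bigr => q /andP[_ /andP[_]]; rewrite negb_or => /andP[h1 h2].
    by rewrite !upd_other.
  - apply: eq_bigr => q /andP[qP /andP[qp h]].
    by have /andP[h1 h2] := P_simple pP qP qp h; rewrite !upd_other.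
  - exact: prod01.
  - exact: prod01.
move=> f /=; rewrite (bigD1 p) // [X in _ - X](bigD1 p) //=.
have -> : \prod_(q in P | q != p) t (p |: S) q (f q.1) (f q.2) =
          \prod_(q in P | q != p) t S q (f q.1) (f q.2).
  by apply: eq_bigr => q /andP[_ qp]; rewrite /t in_setU1 (negPf qp).
have -> : \prod_(q in P | q != p) t S q (f q.1) (f q.2) = Q1 f * Q2 f.
  rewrite (bigID (fun q => (q.1 == p.2) || (q.2 == p.2))) /= mulrC.
  by congr (_ * _); apply: eq_bigl => q; rewrite andbA.
by rewrite /t setU11 (negPf pS); ring.
Qed.

Lemma hybrid :
  mean (fun f : {ffun T -> V} => \prod_(p in P) z p (f p.1) (f p.2)) <=
  mean (fun f : {ffun T -> V} => \prod_(p in P) y p (f p.1) (f p.2)) + #|P|%:R * eps.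
Proof.
suff h n : forall S : {set T * T}, S \subset P -> #|S| = n -> D set0 <= D S + n%:R * eps.
  have := h #|P| P (subxx _) erefl.
  rewrite /D [X in X <= _ -> _](eq_mean (F2 := fun f : {ffun T -> V} => \prod_(p in P) z p (f p.1) (f p.2))).
    rewrite [X in _ <= X + _ -> _](eq_mean (F2 := fun f : {ffun T -> V} => \prod_(p in P) y p (f p.1) (f p.2))) //.
    by move=> f; apply: eq_bigr => p pP; rewrite /t pP.
  by move=> f; apply: eq_bigr => p pP; rewrite /t inE.
elim: n => [|n IHn] S SP.
  by move/eqP; rewrite cards_eq0 => /eqP ->; rewrite mul0r addr0.
move=> cS; have /set0Pn[p pS] : S != set0 by rewrite -cards_eq0 cS.
have pP := subsetP SP p pS.
have := IHn (S :\ p) (subset_trans (subsetDl _ _) SP).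
have cS' : #|S :\ p| = n by move: cS; rewrite (cardsD1 p) pS add1n => -[].
move=> /(_ cS') /le_trans; apply.
have := @hybrid_step (S :\ p) p pP; rewrite !inE eqxx /= setD1K // => /(_ isT).
by rewrite -[in n.+1%:R]natr1 mulrDl mul1r [n%:R * eps + eps]addrC addrA lerD2r.
Qed.

End Counting.

Lemma density_eq (R : realFieldType) (V : finType) : (0 < #|V|)%N ->
  density R (fun a b : V => a == b) = #|V|%:R^-1.
Proof.
move=> V0; rewrite /density.
have -> : #|ordered_edges (fun a b : V => a == b)| = #|V|.
  rewrite card_ordered_edges -sum1_card; apply: eq_bigr => u _.
  by rewrite -(cards1 u); apply: eq_card => w; rewrite !inE eq_sym.
by rewrite expr2 invfM mulrA mulfV ?mul1r // pnatr_eq0 -lt0n.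
Qed.

(** Counting lemma. A is the graph of Avoider, G the graph of all claimed edges;
    2 A - G is the signed indicator, bounded on cuts. The coordinates in W play
    no role except in the density hypothesis on G. *)
Lemma induced_copy_of_density (R : realFieldType) (H : sgraph) (W V : finType)
    (K : eqType) (col : H -> K) (A G : rel V) (c eps : R) :
  (0 < #|V|)%N -> symmetric A -> irreflexive A -> subrel A G ->
  (forall u w : H, sedge u w -> col u != col w) ->
  cut_bounded (fun a b => 2 * (A a b)%:R - (G a b)%:R : R) eps ->
  c <= mean (fun f : {ffun W + H -> V} =>
    [forall u, forall w, (col u != col w) ==> G (f (inr u)) (f (inr w))]%:R) ->
  (#|H| ^ 2)%:R * (eps + #|V|%:R^-1) < c * 2^-1 ^+ (#|H| ^ 2) ->
  exists2 f : {ffun H -> V}, injective f &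
    forall u w : H, sedge u w = A (f u) (f w).
Proof.
move=> V0 Asym Airr AG col_proper cut cG small.
set v2 := (#|H| ^ 2)%N in small *.
have V0R : 0 < #|V|%:R :> R by rewrite ltr0n.
have eps0 : 0 <= eps.
  have := cut set0 set0; rewrite big_set0 normr0.
  by rewrite pmulr_lge0 // exprn_gt0.
pose E : rel (W + H) := fun p q =>
  match p, q with inr u, inr w => sedge u w | _, _ => false end.
(* each unordered pair of vertices of H is listed once *)
pose P0 : {set H * H} := [set p | (enum_rank p.1 < enum_rank p.2)%N].
pose P : {set (W + H) * (W + H)} := [set (inr p.1, inr p.2) | p in P0].
pose z (p : (W + H) * (W + H)) (a b : V) : R :=
  if E p.1 p.2 then (G a b)%:R / 2 else 1 - (G a b)%:R / 2.
pose y (p : (W + H) * (W + H)) (a b : V) : R :=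
  if E p.1 p.2 then (A a b)%:R else 1 - (A a b)%:R.
have cardP : (#|P| <= v2)%N.
  apply: leq_trans (leq_imset_card _ _) _.
  by rewrite /v2 -mulnn -card_prod max_card.
have hyb := @hybrid R _ V V0 P y z eps.
have {}hyb : mean (fun f : {ffun W + H -> V} => \prod_(p in P) z p (f p.1) (f p.2)) <=
    mean (fun f : {ffun W + H -> V} => \prod_(p in P) y p (f p.1) (f p.2)) + v2%:R * eps.
  apply: le_trans (hyb _ _ _ _ _) _.
  - move=> _ /imsetP[[u w] + ->] /=; rewrite inE /= => uw.
    by apply/eqP => -[e]; rewrite e ltnn in uw.
  - move=> _ _ /imsetP[[u w] + ->] /imsetP[[u' w'] + ->] /=; rewrite !inE /= => uw uw'.
    rewrite xpair_eqE ![inr _ == inr _](inj_eq (inr_inj)) => ne.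
    case: (eqVneq u' w) => [e _|/= _ /eqP e]; subst.
      apply/andP; split; apply/eqP => e; subst; lia.
    rewrite eqxx andbT in ne; rewrite ne /=.
    by apply/eqP => e; rewrite e ltnn in uw.
  - by move=> p a b; rewrite /y; case: ifP => _; rewrite ?complement_bounds ?indicator_bounds.
  - by move=> p a b; rewrite /z; case: ifP => _; rewrite
      ?complement_bounds ?half_bounds ?indicator_bounds.
  - move=> p; case Ep: (E p.1 p.2).
      move=> B C; have := @cut_boundedZ _ _ _ eps (- 2^-1) _ cut B C.
      rewrite /z /y Ep => h; apply: le_trans _ (h _); last by rewrite normrN ger0_norm //; lra.
      rewrite le_eqVlt; apply/orP; left; apply/eqP; congr (`|_|).
      by apply: eq_bigr => a _; apply: eq_bigr => b _; field.
    move=> B C; have := @cut_boundedZ _ _ _ eps (2^-1) _ cut B C.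
    rewrite /z /y Ep => h; apply: le_trans _ (h _); last by rewrite ger0_norm //; lra.
    rewrite le_eqVlt; apply/orP; left; apply/eqP; congr (`|_|).
    by apply: eq_bigr => a _; apply: eq_bigr => b _; field.
  by rewrite lerD2l ler_wpM2r // ler_nat.
have zlow : c * 2^-1 ^+ v2 <= mean (fun f : {ffun W + H -> V} => \prod_(p in P) z p (f p.1) (f p.2)).
  rewrite mulrC; apply: le_trans (ler_wpM2l _ cG) _; first by rewrite exprn_ge0 // invr_ge0.
  rewrite -meanZ; apply: ler_mean => f.
  have z0 p a b : 0 <= z p a b.
    by rewrite /z; case: ifP => _; case: (G a b) => /=; lra.
  case: forallP => [proper|_]; last by rewrite mulr0 prodr_ge0.
  rewrite mulr1; apply: (@le_trans _ _ (2^-1 ^+ #|P|)).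
    by apply: ler_wiXn2l => //; [lra | lra].
  rewrite -prodr_const; apply: ler_prod => _ /imsetP[[u w] _ ->] /=.
  rewrite /z /=; case: ifP => uw; last by case: (G _ _) => /=; apply/andP; split; lra.
  have /forallP/(_ w)/implyP/(_ (col_proper _ _ uw)) -> := proper u => /=; apply/andP; split; lra.
(* two given distinct vertices of H have the same image with probability 1 / |V| *)
pose inj_on (f : {ffun W + H -> V}) :=
  [forall u : H, forall w : H, (u != w) ==> (f (inr u) != f (inr w))].
have noninj : mean (fun f => (~~ inj_on f)%:R) <= v2%:R / #|V|%:R :> R.
  have -> : v2%:R / #|V|%:R = \sum_(p : H * H) #|V|%:R^-1 :> R.
    by rewrite sumr_const card_prod /v2 -mulnn -[RHS]mulr_natl.
  apply: (@le_trans _ _ (\sum_(p : H * H | p.1 != p.2) #|V|%:R^-1)); last first.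
    by rewrite [X in X <= _]big_mkcond; apply: ler_sum => p _; case: ifP => //; rewrite invr_ge0 ltW.
  under eq_bigr => p pp.
    rewrite -(density_eq R V0) -(@mean_pair R V (fun a b => a == b) V0 (W + H)%type (inr p.1) (inr p.2)) //.
    over.
  rewrite -mean_sum; apply: ler_mean => f.
  have s0 Q : 0 <= \sum_(p : H * H | Q p) (f (inr p.1) == f (inr p.2))%:R :> R.
    by apply: sumr_ge0.
  rewrite /inj_on; case: forallP => //= no; apply: contrapT => /negP.
  rewrite -ltNge => lt1; apply: no => u; apply/forallP => w; apply/implyP => uw.
  apply/negP => e; move: lt1; rewrite (bigD1 (u, w)) //= e -ltrBrDl subrr.
  by rewrite ltNge s0.
(* hence an injective map for which no factor y vanishes *)
have : 0 < mean (fun f : {ffun W + H -> V} =>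
     \prod_(p in P) y p (f p.1) (f p.2) - (~~ inj_on f)%:R).
  by rewrite meanB; move: small; rewrite mulrDr; lra.
move=> /mean_gt0_witness[f].
have yle1 : \prod_(p in P) y p (f p.1) (f p.2) <= 1.
  have y1 p : 0 <= y p (f p.1) (f p.2) <= 1.
    by rewrite /y; case: ifP => _; rewrite ?complement_bounds ?indicator_bounds.
  by have /andP[] := prod01 (mem P) y1.
case: (boolP (inj_on f)) => [finj|_] /= ygt; last by lra.
rewrite subr0 in ygt.
have inj' u w : f (inr u) = f (inr w) -> u = w.
  move=> e; apply/eqP/negPn/negP => uw.
  by have /forallP/(_ u)/forallP/(_ w) := finj; rewrite uw e eqxx.
exists [ffun u => f (inr u)] => [u w|u w]; rewrite !ffunE; first exact: inj'.
have key (u' w' : H) : (enum_rank u' < enum_rank w')%N -> sedge u' w' = A (f (inr u')) (f (inr w')).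
  move=> uw.
  have pP : (inr u', inr w') \in P by apply/imsetP; exists (u', w'); rewrite ?inE.
  have : y (inr u', inr w') (f (inr u')) (f (inr w')) != 0.
    apply: contraTneq ygt => y0.
    by rewrite (bigD1 _ pP) /= y0 mul0r ltxx.
  by rewrite /y /=; case: (sedge u' w'); case: (A _ _); rewrite ?subrr ?eqxx.
have [uw|uw|/val_inj/enum_rank_inj ->] := ltngtP (enum_rank u) (enum_rank w).
- exact: key.
- by rewrite sedge_sym Asym; exact: key.
- by rewrite sedge_irr Airr.
Qed.

(** * Plays and Avoider's strategy *)

Section Plays.
Variables (n : nat) (af : bool).
Implicit Types (s : seq {set 'I_n}) (e : {set 'I_n}).

Lemma legal_play_rcons s e :
  legal_play (rcons s e) = [&& legal_play s, e \in K_edges n & e \notin s].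
Proof.
rewrite /legal_play rcons_uniq all_rcons /=.
by case: (e \in s); case: (uniq s); case: (e \in K_edges n); case: (all _ _).
Qed.

Lemma legal_play_size s : legal_play s -> (size s <= #|K_edges n|)%N.
Proof.
by case/andP=> us /allP sK; rewrite cardE; apply: uniq_leq_size => // e /sK; rewrite mem_enum.
Qed.

Lemma follows_rcons (sigma : strategy n) s e :
  follows af sigma (rcons s e) <->
  follows af sigma s /\ (~~ avoider_turn af (size s) -> e = sigma s).
Proof.
split=> [h|[h1 h2] i]; last first.
  rewrite size_rcons ltnS leq_eqVlt nth_rcons -cats1 => /predU1P[->|is_] turn.
    by rewrite ltnn eqxx take_size_cat // h2.
  by rewrite is_ takel_cat ?h1 // ltnW.
split=> [i is_ turn|turn].
  have := h i; rewrite size_rcons ltnS ltnW // => /(_ isT turn).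
  by rewrite nth_rcons is_ -cats1 takel_cat // ltnW.
have := h (size s); rewrite size_rcons ltnSn => /(_ isT turn).
by rewrite nth_rcons ltnn eqxx -cats1 take_size_cat.
Qed.

(** If Avoider always plays in P then so do the edges of his graph at any time. *)
Lemma avoider_edges_sub s (P : pred {set 'I_n}) :
  (forall i, (i < size s)%N -> avoider_turn af i -> P (nth set0 s i)) ->
  forall i e, e \in avoider_edges af (take i s) -> P e.
Proof.
move=> h i e; rewrite inE => /andP[es turn].
have : (index e (take i s) < size (take i s))%N by rewrite index_mem.
rewrite size_take_min leq_min => /andP[ji js].
by rewrite -(nth_index set0 es) nth_take //; exact: h.
Qed.

(** Against any strategy, Avoider can play inside E as long as no more than |E|
    moves are made by both players together. *)
Lemma avoider_stays_inside (sigma : strategy n) (E : {set {set 'I_n}}) m :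
  enforcer_strategy af sigma -> E \subset K_edges n -> (m <= #|E|)%N ->
  exists s, [/\ legal_play s, follows af sigma s, size s = m &
    forall i, (i < size s)%N -> avoider_turn af i -> nth set0 s i \in E].
Proof.
move=> strat EK; elim: m => [|m IHm] mE; first by exists [::].
have [s [ls fs ss sE]] := IHm (ltnW mE).
have extend e : legal_play (rcons s e) -> (~~ avoider_turn af m -> e = sigma s) ->
    (avoider_turn af m -> e \in E) ->
    exists s, [/\ legal_play s, follows af sigma s, size s = m.+1 &
    forall i, (i < size s)%N -> avoider_turn af i -> nth set0 s i \in E].
  move=> le es eE; exists (rcons s e); split=> //; last 1 first.
  - move=> i; rewrite size_rcons ltnS leq_eqVlt nth_rcons => /predU1P[->|is_].
      by rewrite ltnn eqxx ss.
    by rewrite is_; exact: sE.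
  - by apply/follows_rcons; rewrite ss.
  - by rewrite size_rcons ss.
have [turn|turn] := boolP (avoider_turn af m).
  have [e eE es] : exists2 e, e \in E & e \notin s.
    have /subsetPn[e eE es] : ~~ (E \subset [set:: s]).
      apply/negP => /subset_leq_card; rewrite leqNgt => /negP; apply.
      rewrite cardsE; apply: leq_ltn_trans mE.
      by rewrite -ss; exact: card_size.
    by exists e; rewrite // inE in es *.
  apply: (extend e) => //; last by rewrite turn.
  by rewrite legal_play_rcons ls (subsetP EK).
apply: (extend (sigma s)) => //; last by rewrite (negPf turn).
apply: strat; rewrite ?ss //.
by apply: leq_trans mE (subset_leq_card EK).
Qed.

Lemma wins_within_sub (P Q : graph_property n) t : (forall E, P E -> Q E) ->
  enforcer_wins_within af P t -> enforcer_wins_within af Q t.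
Proof.
move=> PQ [sigma strat win]; exists sigma => // s ls fs ss.
by have [i si Pi] := win s ls fs ss; exists i => //; exact: PQ.
Qed.

End Plays.

(** * The balancing strategy of Enforcer *)

Section Balancing.
Variables (R : realFieldType) (n : nat) (af : bool).
Variables (J : finType) (c : J -> {set 'I_n} -> int) (lam : R).
Hypotheses (c1 : forall j e, `|c j e| <= 1) (lam0 : 0 <= lam) (lam1 : lam < 1).
Implicit Types (s : seq {set 'I_n}) (e : {set 'I_n}).

(** 1 for a move of Avoider, -1 for a move of Enforcer. *)
Definition turn_sign (i : nat) : int := if avoider_turn af i then 1 else -1.

(** Avoider's total minus Enforcer's total for the test function c j. *)
Definition discrepancy (j : J) s : int :=
  \sum_(i < size s) turn_sign i * c j (nth set0 s i).

(** A multiplicative substitute for (1 + lam) to the power of the discrepancy. *)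
Definition weight (j : J) s : R :=
  \prod_(i < size s) (1 + lam * (turn_sign i * c j (nth set0 s i))%:~R).

(** The decrease of the potential, up to the factor lam, if Enforcer claims e. *)
Definition score s e : R := \sum_j weight j s * (c j e)%:~R.

(** The potential that Enforcer keeps small. *)
Definition potential s : R := \sum_j weight j s.

Definition free_edges s : {set {set 'I_n}} := [set e in K_edges n | e \notin s].

(** Enforcer claims a free edge of maximal score. The value set0 is only taken
    when no edge is free. *)
Definition balancer : strategy n := fun s =>
  if [pick e in free_edges s] is Some e0
  then [arg max_(e > e0 in free_edges s) score s e]%O else set0.

Lemma balancerP s : (size s < #|K_edges n|)%N ->
  balancer s \in free_edges s /\ forall e, e \in free_edges s -> score s e <= score s (balancer s).
Proof.
move=> small; rewrite /balancer; case: pickP => [e0 fe0|none].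
  by case: arg_maxP => // e fe emax; split=> // e' /emax.
exfalso; move: small; rewrite ltnNge => /negP; apply.
apply: leq_trans (card_size s); apply: subset_leq_card.
by apply/subsetP => e eK; apply/negPn/negP => es; have := none e; rewrite in_set eK es.
Qed.

Lemma balancer_strategy : enforcer_strategy af balancer.
Proof.
move=> s ls small _; rewrite legal_play_rcons ls.
by have [/setIdP[-> ->] _] := balancerP small.
Qed.

Lemma weight_rcons j s e :
  weight j (rcons s e) = weight j s * (1 + lam * (turn_sign (size s) * c j e)%:~R).
Proof.
rewrite /weight size_rcons big_ord_recr /= nth_rcons ltnn eqxx; congr (_ * _).
by apply: eq_bigr => i _; rewrite nth_rcons ltn_ord.
Qed.

Lemma discrepancy_rcons j s e :
  discrepancy j (rcons s e) = discrepancy j s + turn_sign (size s) * c j e.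
Proof.
rewrite /discrepancy size_rcons big_ord_recr /= nth_rcons ltnn eqxx; congr (_ + _).
by apply: eq_bigr => i _; rewrite nth_rcons ltn_ord.
Qed.

Lemma turn_signP i : {turn_sign i = 1} + {turn_sign i = -1}.
Proof. by rewrite /turn_sign; case: avoider_turn; [left|right]. Qed.

Lemma c_cases j e : [\/ c j e = 0, c j e = 1 | c j e = -1].
Proof.
have := c1 j e; case: (c j e) => [[|[|m]]|[|m]] h;
  first [by constructor 1 | by constructor 2 | by constructor 3 | exfalso; lia].
Qed.

Lemma signed_cases i j e :
  [\/ turn_sign i * c j e = 0, turn_sign i * c j e = 1 | turn_sign i * c j e = -1].
Proof.
by case: (turn_signP i) => ->; case: (c_cases j e) => ->; rewrite ?mul1r ?mulN1r ?opprK ?oppr0;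
  first [by constructor 1 | by constructor 2 | by constructor 3].
Qed.

Lemma weight_ge0 j s : 0 <= weight j s.
Proof.
apply: prodr_ge0 => i _.
by case: (signed_cases i j (nth set0 s i)) => ->; rewrite ?rmorphN1 ?rmorph1 ?rmorph0; move: lam0 lam1; nra.
Qed.

Lemma potential_nil : potential [::] = #|J|%:R.
Proof. by rewrite /potential /weight; under eq_bigr do rewrite big_ord0; rewrite sumr_const. Qed.

Lemma potential_rcons s e : potential (rcons s e) <= 2 * potential s.
Proof.
rewrite /potential big_distrr; apply: ler_sum => j _; rewrite weight_rcons mulrC.
apply: ler_wpM2r; first exact: weight_ge0.
by case: (signed_cases (size s) j e) => ->; rewrite ?rmorphN1 ?rmorph1 ?rmorph0; move: lam0 lam1; nra.
Qed.

(** One move of Enforcer followed by one of Avoider. The first order terms do not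
    increase the potential, since Avoider's edge e was available to Enforcer;
    only the product of the two increments remains. *)
Lemma potential_round s e : legal_play (rcons (rcons s (balancer s)) e) ->
  ~~ avoider_turn af (size s) ->
  potential (rcons (rcons s (balancer s)) e) <= (1 + lam ^+ 2) * potential s.
Proof.
move=> lp turn; set b := balancer s in lp *.
have lp' : legal_play (rcons s b) by move: lp; rewrite legal_play_rcons => /and3P[].
have small : (size s < #|K_edges n|)%N.
  by have := legal_play_size lp'; rewrite size_rcons.
have [_ bmax] := balancerP small.
have {bmax} le_score : score s e <= score s b.
  apply: bmax; apply/setIdP; move: lp; rewrite legal_play_rcons => /and3P[_ -> /=].
  by rewrite mem_rcons inE negb_or => /andP[].
have signs : turn_sign (size s) = -1 /\ turn_sign (size s).+1 = 1.
  move: turn; rewrite /turn_sign /avoider_turn /=; case: af; by case: (odd _).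
have {}signs j : weight j (rcons (rcons s b) e) <=
    (1 + lam ^+ 2) * weight j s + lam * (weight j s * (c j e)%:~R - weight j s * (c j b)%:~R).
  rewrite !weight_rcons size_rcons; case: signs => -> ->.
  rewrite mul1r mulN1r rmorphN /=; have := weight_ge0 j s; set w := weight j s => w0.
  have cc : - ((c j b)%:~R * (c j e)%:~R) <= 1 :> R.
    case: (c_cases j b) => ->; case: (c_cases j e) => ->;
      rewrite ?rmorphN1 ?rmorph1 ?rmorph0; lra.
  set x : R := (c j b)%:~R in cc *; set y : R := (c j e)%:~R in cc *.
  rewrite -subr_ge0.
  have -> : (1 + lam ^+ 2) * w + lam * (w * y - w * x) - w * (1 + lam * - x) * (1 + lam * y) =
     w * lam ^+ 2 * (1 + x * y) by ring.
  by rewrite mulr_ge0 ?mulr_ge0 ?exprn_ge0 //; lra.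
apply: le_trans (ler_sum _ (fun j _ => signs j)) _.
rewrite big_split /= -!big_distrr /= gerDl sumrB.
by rewrite mulr_ge0_le0 // subr_le0.
Qed.

(** Of the factor 4, one factor 2 accounts for a first move by Avoider and the
    other one for a last move by Enforcer. *)
Lemma potential_bound s : legal_play s -> follows af balancer s ->
  potential s <= 4 * #|J|%:R * (1 + lam ^+ 2) ^+ size s.
Proof.
have L1 : 1 <= 1 + lam ^+ 2 by rewrite lerDl exprn_ge0.
(* plays in which Enforcer is to move, two moves at a time *)
suff h m : forall s, (size s <= m)%N -> legal_play s -> follows af balancer s ->
    ~~ avoider_turn af (size s) -> potential s <= 2 * #|J|%:R * (1 + lam ^+ 2) ^+ size s.
  move=> ls fs; have [turn|turn] := boolP (avoider_turn af (size s)); last first.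
    apply: le_trans (h _ s (leqnn _) ls fs turn) _.
    have : 0 <= #|J|%:R * (1 + lam ^+ 2) ^+ size s.
      by rewrite mulr_ge0 // exprn_ge0 // (le_trans _ L1).
    by set X := _ ^+ size s; set N : R := #|J|%:R; nra.
  case/lastP: s ls fs turn => [|s e] ls fs turn.
    by rewrite potential_nil /= expr0 mulr1 ler_peMl ?ler1n ?ler0n.
  apply: le_trans (potential_rcons _ _) _.
  move: ls fs turn; rewrite legal_play_rcons size_rcons => /and3P[ls _ _] /follows_rcons[fs _] turn.
  have turn' : ~~ avoider_turn af (size s).
    by move: turn; rewrite /avoider_turn /=; case: af; case: odd.
  have := h _ s (leqnn _) ls fs turn'.
  have : 0 <= #|J|%:R * (1 + lam ^+ 2) ^+ size s by rewrite mulr_ge0 ?exprn_ge0 // (le_trans _ L1).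
  move: L1; set L := 1 + lam ^+ 2; rewrite exprS.
  set X := _ ^+ size s; set N : R := #|J|%:R => L1 NX0 hs.
  have := ler_wpM2r NX0 L1; lra.
elim: m => [|m IHm] {}s; case/lastP: s => [|s e]; rewrite ?size_rcons //.
- move=> _ _ _ _; by rewrite potential_nil /= expr0 mulr1 ler_peMl ?ler1n ?ler0n.
- move=> _ _ _ _; by rewrite potential_nil /= expr0 mulr1 ler_peMl ?ler1n ?ler0n.
rewrite ltnS => sm ls fs turn.
case/lastP: s sm ls fs turn => [|s b].
  move=> _ _ _ _; apply: le_trans (potential_rcons _ _) _.
  by rewrite potential_nil /= expr1 ler_peMr // mulr_ge0.
rewrite size_rcons => sm ls /follows_rcons[/follows_rcons[fs eb] _] turn.
have turn' : ~~ avoider_turn af (size s).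
  by move: turn; rewrite /avoider_turn /= negbK.
rewrite {}eb // in ls *.
apply: le_trans (potential_round ls turn') _.
have ls' : legal_play s by move: ls; rewrite !legal_play_rcons => /and3P[/and3P[]].
have := IHm s (ltnW sm) ls' fs turn'.
move: L1; set L := 1 + lam ^+ 2 => L1; rewrite !(exprS L).
set X := _ ^+ size s; set N : R := #|J|%:R => h.
have X0 : 0 <= X by rewrite exprn_ge0 // (le_trans _ L1).
have N0 : 0 <= N by rewrite ler0n.
have -> : 2 * N * (L * (L * X)) = L * (L * (2 * N * X)) by ring.
rewrite ler_wpM2l ?(le_trans _ L1) //; apply: le_trans h _.
by rewrite ler_peMl // !mulr_ge0.
Qed.

(** Factor by factor: 1 + lam y >= (1 - lam^2) (1 + lam)^y for y in {-1, 0, 1}. *)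
Lemma weight_discrepancy j s :
  (1 - lam ^+ 2) ^+ size s * (1 + lam) ^ (discrepancy j s) <= weight j s.
Proof.
have l1 : 1 + lam != 0 by rewrite gt_eqF // ltr_wpDr.
have l2 : 0 <= 1 - lam ^+ 2 by rewrite subr_ge0 exprn_ile1 // ltW.
elim/last_ind: s => [|s e IHs].
  by rewrite /discrepancy /weight !big_ord0 expr0z mulr1.
rewrite weight_rcons discrepancy_rcons size_rcons expfzDr // exprS.
rewrite -mulrA mulrCA mulrA mulrACA.
set y := turn_sign _ * _.
have step : (1 - lam ^+ 2) * (1 + lam) ^ y <= 1 + lam * y%:~R.
  rewrite /y; case: (signed_cases (size s) j e) => ->.
  - by rewrite expr0z mulr1 rmorph0 mulr0 addr0 lerBlDr lerDl exprn_ge0.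
  - by rewrite expr1z rmorph1 mulr1 ler_piMl ?addr_ge0 // lerBlDr lerDl exprn_ge0.
  - rewrite exprN1 rmorphN1 mulrN1 (_ : 1 - lam ^+ 2 = (1 - lam) * (1 + lam)); last by ring.
    by rewrite mulfK.
apply: le_trans (ler_pM _ _ IHs step) _ => //.
- by rewrite mulr_ge0 ?exprn_ge0 // exprz_ge0 // addr_ge0.
- by rewrite mulr_ge0 // exprz_ge0 // addr_ge0.
Qed.

Lemma discrepancy_bound (D : nat) s j :
  legal_play s -> follows af balancer s ->
  4 * #|J|%:R * (1 + lam ^+ 2) ^+ size s < (1 - lam ^+ 2) ^+ size s * (1 + lam) ^+ D.+1 ->
  discrepancy j s <= D%:Z.
Proof.
move=> ls fs big; rewrite leNgt; apply/negP => Dlt.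
have := lt_le_trans big; move=> /(_ (weight j s)) => h.
have : weight j s <= potential s.
  by rewrite /potential (bigD1 j) //= lerDl sumr_ge0 // => i _; exact: weight_ge0.
rewrite leNgt => /negP; apply.
apply: le_lt_trans (potential_bound ls fs) _; apply: h.
apply: le_trans (weight_discrepancy j s).
rewrite ler_wpM2l //; first by rewrite exprn_ge0 // subr_ge0 exprn_ile1 // ltW.
rewrite exprnP ler_weXz2l //; first by rewrite lerDl.
Qed.

End Balancing.

(** * Choice of the parameters of the balancing strategy *)

Lemma exprD1_le (R : realFieldType) (y : R) (m : nat) : 0 <= y <= 1 ->
  (1 + y) ^+ m <= 1 + (2 ^+ m - 1) * y.
Proof.
move=> /andP[y0 y1]; elim: m => [|m IHm]; first by rewrite !expr0 subrr mul0r addr0.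
rewrite exprS; apply: le_trans (ler_wpM2l _ IHm) _; first by rewrite addr_ge0.
have : 1 <= 2 ^+ m :> R by rewrite exprn_ege1 // ler1n.
rewrite [in X in _ -> _ <= X]exprS; set c := 2 ^+ m => c1.
rewrite -subr_ge0.
have -> : 1 + (2 * c - 1) * y - (1 + y) * (1 + (c - 1) * y) = (c - 1) * (y * (1 - y)) by ring.
by rewrite !mulr_ge0 // subr_ge0.
Qed.

Lemma bernoulli (R : realFieldType) (y : R) (m : nat) : 0 <= y -> 1 + m%:R * y <= (1 + y) ^+ m.
Proof.
move=> y0; elim: m => [|m IHm]; first by rewrite mul0r addr0 expr0.
rewrite exprS; apply: le_trans (ler_wpM2l _ IHm); last by rewrite addr_ge0.
rewrite -natr1; have : 0 <= m%:R * y * y by rewrite !mulr_ge0.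
by set M : R := m%:R => h; nra.
Qed.

(** For the 2 * 4^n tests that describe cuts, and plays of at most n^2 moves, a
    constant lam makes [discrepancy_bound] give a discrepancy of at most
    eps n^2 / 2: with L = 1 + 3 lam^2, the term (1 + lam)^(D + 1) is at least
    L^(2 n^2), which beats both the drift (1 + lam^2) / (1 - lam^2) <= L of each
    move and the exponential number of tests. *)
Lemma balancing_parameters (R : archiRealFieldType) (eps : R) : 0 < eps ->
  exists n1 (lam : R), [/\ 0 <= lam, lam < 1 & forall n, (n1 <= n)%N ->
    exists2 D : nat, 2 * D%:R <= eps * n%:R ^+ 2 &
    forall m, (m <= n ^ 2)%N ->
    4 * (2 * 2 ^ n * 2 ^ n)%:R * (1 + lam ^+ 2) ^+ m < (1 - lam ^+ 2) ^+ m * (1 + lam) ^+ D.+1].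
Proof.
move=> eps0.
have aux1 (k l : nat) : (0 < k -> 6 * k <= l -> 2 * l + 4 <= 6 * l)%N by lia.
have aux2 (k : nat) : (0 < k -> 4 * (2 * k) < k * 2 ^ 4)%N by lia.
(* the parameters are D = n^2 %/ p and lam = 1 / Q, where Q = 3 * 4^p *)
pose p := (Num.bound (2 / eps)).
have pe : 2 <= eps * p%:R.
  rewrite mulrC -ler_pdivrMr //.
  by apply/ltW/archi_boundP; rewrite divr_ge0 // ltW.
have p0 : (0 < p)%N.
  by rewrite lt0n; apply/eqP => e; move: pe; rewrite e mulr0; lra.
pose Q := (3 * 2 ^ (2 * p))%N.
have Q0 : (0 < Q)%N by rewrite muln_gt0 expn_gt0.
have Q3 : (3 <= Q)%N by rewrite leq_pmulr // expn_gt0.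
have QR : 3 <= Q%:R :> R by rewrite ler_nat.
pose lam : R := Q%:R^-1.
have lam0 : 0 < lam by rewrite invr_gt0; lra.
have lam3 : lam <= 3^-1 by rewrite lef_pV2 // posrE; lra.
have lamQ : lam * Q%:R = 1 by rewrite mulVf // gt_eqF //; lra.
have sq : 3 * lam ^+ 2 <= 1 by rewrite expr2; nra.
have sq0 : 0 <= 3 * lam ^+ 2 by rewrite mulr_ge0 ?exprn_ge0 // ltW.
pose L := 1 + 3 * lam ^+ 2.
have L1 : 1 <= L by rewrite lerDl.
exists (6 * Q ^ 2)%N, lam; split; [exact: ltW | lra | move=> n nbig].
exists (n ^ 2 %/ p)%N => [|m mn].
  have : (n ^ 2 %/ p)%:R * p%:R <= n%:R ^+ 2 :> R by rewrite -natrM -natrX ler_nat leq_divM.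
  set D : R := (_ %/ _)%:R => h.
  have D0 : 0 <= D by rewrite ler0n.
  apply: le_trans (ler_wpM2l (ltW eps0) h).
  by rewrite mulrCA [2 * D]mulrC; apply: ler_wpM2l.
set D := (n ^ 2 %/ p)%N.
have D1 : (n ^ 2 <= p * D.+1)%N.
  by rewrite mulnC ltnW // /D ltn_ceil.
(* (1 + 3 lam^2)^(2p) <= 1 + lam by the choice of lam *)
have Lp : L ^+ (2 * p) <= 1 + lam.
  apply: le_trans (@exprD1_le R (3 * lam ^+ 2) _ _) _; first by rewrite sq0.
  rewrite lerD2l; have -> : 2 ^+ (2 * p) = Q%:R / 3 :> R.
    by rewrite /Q natrM natrX mulrAC divff ?mul1r ?pnatr_eq0.
  have -> : (Q%:R / 3 - 1) * (3 * lam ^+ 2) = lam * (lam * Q%:R) - 3 * lam ^+ 2.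
    by move: (Q%:R : R) (lam) => q l; field.
  by rewrite lamQ mulr1 gerBl.
have up : L ^+ (n ^ 2 + m) <= (1 + lam) ^+ D.+1.
  apply: (@le_trans _ _ (L ^+ (2 * p) ^+ D.+1)); last first.
    by rewrite lerXn2r // nnegrE ?exprn_ge0 ?addr_ge0 // ?ltW // (le_trans _ L1).
  by rewrite -exprM ler_weXn2l // -mulnA mul2n -addnn leq_add // (leq_trans mn).
have low : (1 + lam ^+ 2) ^+ m <= (1 - lam ^+ 2) ^+ m * L ^+ m.
  have l2 : 0 <= lam ^+ 2 by rewrite exprn_ge0 // ltW.
  rewrite -exprMn lerXn2r // ?nnegrE.
  - by rewrite addr_ge0.
  - by rewrite mulr_ge0 ?(le_trans _ L1) //; lra.
  - rewrite /L; set x := lam ^+ 2 in l2 sq *; nra.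
have grow : 4 * (2 * 2 ^ n * 2 ^ n)%:R < L ^+ (n ^ 2).
  have L2 : 2 <= L ^+ (Q ^ 2).
    apply: le_trans (bernoulli _ sq0); rewrite natrX.
    have -> : 1 + Q%:R ^+ 2 * (3 * lam ^+ 2) = 1 + 3 * (lam * Q%:R) ^+ 2.
      by move: (Q%:R : R) (lam) => q l; ring.
    by rewrite lamQ expr1n; lra.
  apply: (@lt_le_trans _ _ (L ^+ (Q ^ 2 * (2 * n + 4)))); last first.
    rewrite ler_weXn2l //; apply: (@leq_trans (6 * Q ^ 2 * n)); last first.
      by rewrite -mulnn leq_mul2r nbig orbT.
    rewrite mulnAC mulnC leq_mul2r; apply/orP; right.
    by apply: aux1 nbig; rewrite expn_gt0 Q0.
  rewrite exprM; apply: (@lt_le_trans _ _ (2 ^+ (2 * n + 4))); last first.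
    by rewrite lerXn2r // nnegrE // exprn_ge0 // (le_trans _ L1).
  rewrite -natrX -natrM ltr_nat (mul2n n) -addnn !expnD.
  by rewrite -(mulnA 2%N); apply: aux2; rewrite muln_gt0 expn_gt0.
have Lm0 : 0 < (1 - lam ^+ 2) ^+ m * L ^+ m.
  apply: lt_le_trans low; rewrite exprn_gt0 // ltr_wpDr //.
  by rewrite exprn_ge0 // ltW.
apply: (@lt_le_trans _ _ ((1 - lam ^+ 2) ^+ m * L ^+ (n ^ 2 + m))); last first.
  by rewrite ler_wpM2l // exprn_ge0 // subr_ge0 exprn_ile1 //; lra.
rewrite exprD mulrCA.
apply: (@le_lt_trans _ _ (4 * (2 * 2 ^ n * 2 ^ n)%:R * ((1 - lam ^+ 2) ^+ m * L ^+ m))).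
  by rewrite ler_wpM2l // mulr_ge0.
by rewrite ltr_pM2r.
Qed.

(** * Edges as pairs of vertices, and balance on cuts *)

Lemma set2_eq (T : finType) (a b u w : T) : u != w ->
  ([set a; b] == [set u; w]) = ((a == u) && (b == w)) || ((a == w) && (b == u)).
Proof.
move=> uw; apply/eqP/orP => [e|[] /andP[/eqP -> /eqP ->] //]; last exact: setUC.
have wab : w \in [set a; b] by rewrite e set22.
have uab : u \in [set a; b] by rewrite e set21.
have /set2P[au|aw] : a \in [set u; w] by rewrite -e set21.
  left; rewrite au eqxx /=; move: wab; rewrite !inE au eq_sym (negPf uw) /=.
  by rewrite eq_sym.
right; rewrite aw eqxx /=; move: uab; rewrite !inE aw (negPf uw) /=.
by rewrite eq_sym.
Qed.

Lemma K_edgesP n (e : {set 'I_n}) :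
  reflect (exists u w : 'I_n, (u < w)%N /\ e = [set u; w]) (e \in K_edges n).
Proof.
rewrite inE; apply: (iffP (cards2P _)) => [[u [w [uw ->]]]|[u [w [uw ->]]]].
  move: uw; rewrite -val_eqE neq_ltn => /orP[] uw; first by exists u, w.
  by exists w, u; split=> //; exact: setUC.
by exists u, w; split=> //; rewrite -val_eqE neq_ltn uw.
Qed.

Lemma set2_K_edges n (a b : 'I_n) : ([set a; b] \in K_edges n) = (a != b).
Proof. by rewrite inE cards2; case: (a != b). Qed.

Lemma card_adj n (E : {set {set 'I_n}}) : E \subset K_edges n ->
  #|ordered_edges (adj E)| = (2 * #|E|)%N.
Proof.
move=> EK.
have -> : #|ordered_edges (adj E)| =
    (\sum_(e in E) #|[set p : 'I_n * 'I_n | [set p.1; p.2] == e]|)%N.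
  rewrite -sum1_card (eq_bigl (fun p : 'I_n * 'I_n => [set p.1; p.2] \in E)); last first.
    move=> p; rewrite inE /adj; case: (boolP (_ \in E)) => [/(subsetP EK)|_]; last by rewrite andbF.
    by rewrite set2_K_edges => ->.
  rewrite (partition_big (fun p : 'I_n * 'I_n => [set p.1; p.2]) (mem E)) //=.
  apply: eq_bigr => e eE; rewrite -sum1_card; apply: eq_bigl => p.
  by rewrite [RHS]inE andb_idl // => /eqP ->.
rewrite mulnC -sum_nat_const; apply: eq_bigr => e /(subsetP EK)/K_edgesP[u [w [uw ->]]].
have neq : u != w by rewrite -val_eqE neq_ltn uw.
rewrite (_ : [set p | _] = [set (u, w); (w, u)]).
  by rewrite cards2 xpair_eqE (negPf neq).
by apply/setP => -[a b]; rewrite !inE /= set2_eq // !xpair_eqE.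
Qed.

Section CutFromPlay.
Variables (n : nat) (af : bool).

(** The pairs in A * B, listed in increasing order, that are the two ends of e;
    there is at most one. The orientation keeps the tests bounded by 1 even when
    A and B overlap. *)
Definition increasing_pairs (A B : {set 'I_n}) (e : {set 'I_n}) :=
  [set p : 'I_n * 'I_n | [&& p.1 \in A, p.2 \in B, (p.1 < p.2)%N & e == [set p.1; p.2]]].

Lemma increasing_pairs_le1 A B e : (#|increasing_pairs A B e| <= 1)%N.
Proof.
apply/card_le1_eqP => -[a b] [a' b']; rewrite !inE /= => /and4P[_ _ ab /eqP ->] /and4P[_ _ ab'].
rewrite set2_eq; last by rewrite -val_eqE neq_ltn ab'.
case/orP=> /andP[/eqP ? /eqP ?]; subst => //.
by have := ltn_trans ab ab'; rewrite ltnn.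
Qed.

(** The test attached to a sign and to the sets A and B; both signs are needed to
    bound the discrepancy on both sides. *)
Definition cut_test (j : bool * {set 'I_n} * {set 'I_n}) (e : {set 'I_n}) : int :=
  (-1) ^+ j.1.1 * #|increasing_pairs j.1.2 j.2 e|%:Z.

Lemma cut_test_le1 j e : `|cut_test j e| <= 1.
Proof.
rewrite /cut_test normrM normrX normrN1 expr1n mul1r ger0_norm //.
by rewrite lez_nat increasing_pairs_le1.
Qed.

Lemma cut_test_sum (A B : {set 'I_n}) e : e \in K_edges n ->
  \sum_(a in A) \sum_(b in B) (e == [set a; b])%:Z =
  cut_test (false, A, B) e + cut_test (false, B, A) e.
Proof.
case/K_edgesP => u [w [uw ->]].
have neq : u != w by rewrite -val_eqE neq_ltn uw.
have wu : (w < u)%N = false by rewrite ltnNge ltnW.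
have test C D : cut_test (false, C, D) [set u; w] = ((u \in C) && (w \in D))%:Z.
  rewrite /cut_test /= expr0 mul1r; congr Posz.
  case: (boolP (_ && _)) => [/andP[uC wD]|no].
    rewrite -[RHS](cards1 (u, w)); apply: eq_card => -[a b].
    rewrite !inE xpair_eqE /= [_ == [set a; b]]eq_sym set2_eq //.
    apply/and4P/andP => [[_ _ ab /orP[/andP[] //|]]|[/eqP -> /eqP ->]]; last by rewrite !eqxx.
    by case/andP=> /eqP ea /eqP eb; rewrite ea eb wu in ab.
  apply/eqP; rewrite cards_eq0 -subset0; apply/subsetP => -[a b]; rewrite !inE /=.
  rewrite eq_sym set2_eq // => /and4P[aC bD ab /orP[]] /andP[/eqP ea /eqP eb].
    by move: no; rewrite -ea -eb aC bD.
  by rewrite ea eb wu in ab.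
rewrite !test.
have -> : \sum_(a in A) \sum_(b in B) ([set u; w] == [set a; b])%:Z =
   \sum_(a in A) \sum_(b in B) (((a == u) && (b == w))%:Z + ((a == w) && (b == u))%:Z).
  apply: eq_bigr => a _; apply: eq_bigr => b _; rewrite eq_sym set2_eq //.
  have [->|au] := eqVneq a u; have [bw|bw] := eqVneq b w; rewrite /= ?(negPf neq) ?andbF //.
under eq_bigr do rewrite big_split /=.
have delta (C D : {set 'I_n}) (x y : 'I_n) :
   \sum_(a in C) \sum_(b in D) ((a == x) && (b == y))%:Z = ((x \in C) && (y \in D))%:Z.
  rewrite big_mkcond (bigD1 x) //= [X in _ + X]big1 ?addr0; last first.
    by move=> a ax; case: ifP => // _; rewrite big1 // => b _; rewrite (negPf ax).
  case: ifP => // _; rewrite big_mkcond (bigD1 y) //= [X in _ + X]big1 ?addr0 ?eqxx.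
    by case: ifP.
  by move=> b /negPf by_; rewrite by_ andbF; case: ifP.
by rewrite big_split /= !delta [(w \in A) && _]andbC.
Qed.

Lemma signed_edge (R : realFieldType) (s : seq {set 'I_n}) (a b : 'I_n) : legal_play s ->
  2 * (adj (avoider_edges af s) a b)%:R - (adj [set:: s] a b)%:R =
  (\sum_(i < size s) turn_sign af i * (nth set0 s i == [set a; b])%:Z)%:~R :> R.
Proof.
case/andP=> us /allP sK; rewrite /adj !inE.
have [es|es] := boolP ([set a; b] \in s); last first.
  rewrite andbF mulr0 subrr big1 // => i _.
  rewrite (_ : _ == _ = false) ?mulr0 //; apply: contraNF es => /eqP <-.
  exact: mem_nth.
have := sK _ es; rewrite /= set2_K_edges => -> /=.
have is_ : (index [set a; b] s < size s)%N by rewrite index_mem.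
rewrite (bigD1 (Ordinal is_)) //= nth_index // eqxx mulr1 big1 ?addr0 => [|i].
  by rewrite /turn_sign; case: (avoider_turn _ _) => /=; rewrite ?rmorph1 ?rmorphN1; ring.
rewrite -val_eqE /= => ne; rewrite (_ : _ == _ = false) ?mulr0 //.
by apply: contraNF ne => /eqP <-; rewrite index_uniq.
Qed.

Lemma cut_discrepancy (R : realFieldType) (s : seq {set 'I_n}) (A B : {set 'I_n}) :
  legal_play s ->
  \sum_(a in A) \sum_(b in B)
    (2 * (adj (avoider_edges af s) a b)%:R - (adj [set:: s] a b)%:R) =
  (discrepancy af cut_test (false, A, B) s + discrepancy af cut_test (false, B, A) s)%:~R :> R.
Proof.
move=> ls; under eq_bigr do under eq_bigr do rewrite signed_edge //.
under eq_bigr do rewrite -rmorph_sum /=.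
rewrite -rmorph_sum /=; congr (_%:~R).
under eq_bigr do rewrite exchange_big /=.
rewrite exchange_big /= /discrepancy -big_split /=; apply: eq_bigr => i _.
rewrite -mulrDr -cut_test_sum; last first.
  by case/andP: ls => _ /allP; apply; exact: mem_nth.
by rewrite big_distrr; apply: eq_bigr => a _; rewrite big_distrr.
Qed.

Lemma discrepancy_opp s A B :
  discrepancy af cut_test (true, A, B) s = - discrepancy af cut_test (false, A, B) s.
Proof.
rewrite /discrepancy -sumrN; apply: eq_bigr => i _.
by rewrite /cut_test /= expr0 expr1 mul1r mulN1r mulrN.
Qed.

End CutFromPlay.

(** For n large, Enforcer can keep the signed indicator of the claimed edges
    bounded on all cuts at all times, whoever starts. *)
Lemma enforcer_balances (R : archiRealFieldType) (eps : R) : 0 < eps ->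
  exists n1, forall n, (n1 <= n)%N -> forall af,
  exists2 sigma : strategy n, enforcer_strategy af sigma &
    forall s, legal_play s -> follows af sigma s ->
    cut_bounded (fun a b => 2 * (adj (avoider_edges af s) a b)%:R - (adj [set:: s] a b)%:R) eps.
Proof.
move=> /balancing_parameters[n1 [lam [lam0 lam1 params]]].
exists n1 => n n1n af; have [D Deps ineq] := params n n1n.
exists (balancer af (@cut_test n) lam); first exact: balancer_strategy.
move=> s ls fs A B; rewrite card_ord cut_discrepancy //.
have bound j : discrepancy af (@cut_test n) j s <= D.
  apply: (discrepancy_bound (@cut_test_le1 n) lam0 lam1 j ls fs).
  have cardS : #|{set 'I_n}| = (2 ^ n)%N by rewrite -cardsT -powersetT card_powerset cardsT card_ord.
  rewrite !card_prod card_bool cardS; apply: ineq.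
  apply: leq_trans (legal_play_size ls) _.
  rewrite -(leq_pmul2l (isT : 0 < 2)%N) -card_adj //.
  apply: leq_trans (max_card _) _; rewrite card_prod card_ord mulnn.
  by rewrite leq_pmull.
apply: le_trans Deps; rewrite -intr_norm.
have := bound (false, A, B); have := bound (false, B, A).
have := bound (true, A, B); have := bound (true, B, A); rewrite !discrepancy_opp.
set x := discrepancy _ _ _ _; set y := discrepancy _ _ _ _ => h1 h2 h3 h4.
have : `|y + x| <= 2 * D%:Z by lia.
by rewrite -(ler_int R) rmorphM.
Qed.

(** * Enforcer forces an induced copy *)

Lemma double_card_K_edges n : (2 * #|K_edges n| = n * n.-1)%N.
Proof. by rewrite /K_edges card_draws card_ord -mul_bin_diag bin1. Qed.

(** [induced_copy_of_density] with its density hypothesis supplied by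
    [multipartite_supersaturation], and with constants that depend only on H, r
    and delta. *)
Lemma induced_copy_threshold (R : archiRealFieldType) (H : sgraph) (r : nat) (delta : R) :
  (0 < r)%N -> colorable H r.+1 -> 0 < delta ->
  exists2 eps : R, 0 < eps &
  exists n1, forall (V : finType) (A G : rel V), (n1 <= #|V|)%N -> (0 < #|V|)%N ->
    symmetric A -> irreflexive A -> symmetric G -> irreflexive G -> subrel A G ->
    1 - r%:R^-1 + delta <= density R G ->
    cut_bounded (fun a b => 2 * (A a b)%:R - (G a b)%:R) eps ->
    exists2 f : {ffun H -> V}, injective f & forall u w : H, sedge u w = A (f u) (f w).
Proof.
move=> r0 /existsP[col /forallP colP] delta0.
pose m := (Num.bound (2 / delta)).
have dm : 2 <= delta * m%:R.
  rewrite mulrC -ler_pdivrMr //.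
  by apply/ltW/archi_boundP; rewrite divr_ge0 // ltW.
have m0 : (0 < m)%N.
  by rewrite lt0n; apply/eqP => e; move: dm; rewrite e mulr0; lra.
pose c := (delta / 2 / (m ^ r.+1)%:R) ^+ (2 ^ #|H|).
pose v2 := (#|H| ^ 2)%N.
have c0 : 0 < c * 2^-1 ^+ v2.
  rewrite mulr_gt0 ?exprn_gt0 ?invr_gt0 //.
  by rewrite !divr_gt0 // ltr0n expn_gt0 m0.
(* so that 2 |H|^2 eps < c / 2^(|H|^2), and 1 / |V| <= eps for |V| large *)
pose eps := c * 2^-1 ^+ v2 / (2 * v2.+1%:R).
have eps0 : 0 < eps by rewrite divr_gt0 // mulr_gt0 // ltr0n.
exists eps => //; exists (Num.bound eps^-1) => V A G nV V0 Asym Airr Gsym Girr AG dens cut.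
apply: (@induced_copy_of_density R H 'I_m V _ col A G c eps) => //.
- by move=> u w uw; have /forallP/(_ w)/implyP := colP u; apply.
- exact: multipartite_supersaturation.
rewrite -/v2.
have V0R : 0 < #|V|%:R :> R by rewrite ltr0n.
have nle : #|V|%:R^-1 <= eps.
  rewrite -[eps]invrK lef_pV2 ?posrE ?invr_gt0 //.
  apply: le_trans (ltW (archi_boundP _)) _; first by rewrite invr_ge0 ltW.
  by rewrite ler_nat.
have e2 : c * 2^-1 ^+ v2 = eps * (2 * v2.+1%:R).
  by rewrite /eps divfK // mulf_neq0 // pnatr_eq0.
rewrite e2 -natr1.
have : 0 <= v2%:R :> R by [].
by move: nle eps0; set x := #|V|%:R^-1; set v : R := v2%:R; nra.
Qed.

Lemma enforcer_forces_induced_copy (R : archiRealFieldType) (H : sgraph) (r : nat) (delta : R) af :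
  (0 < r)%N -> colorable H r.+1 -> 0 < delta ->
  exists n1, forall n t, (n1 <= n)%N ->
    (1 - r%:R^-1 + delta) * n%:R ^+ 2 <= 4 * t%:R ->
    enforcer_wins_within af (fun E : {set {set 'I_n}} => has_induced_copy H (graph_of E)) t.
Proof.
move=> r0 Hcol delta0.
have rR : 0 < r%:R :> R by rewrite ltr0n.
(* delta is lowered so that the complete graph on n >= 2 r vertices has density
   at least 1 - 1 / r + delta': this serves plays that exhaust all the edges *)
pose delta' := Num.min delta ((2 * r%:R)^-1).
have delta'0 : 0 < delta' by rewrite lt_min delta0 invr_gt0 mulr_gt0.
have [eps eps0 [n1 copy]] := induced_copy_threshold r0 Hcol delta'0.
have [n2 balance] := enforcer_balances eps0.
exists (maxn 1 (maxn n1 (maxn n2 (2 * r)))) => n t; rewrite !geq_max => /and4P[n0 n1n n2n rn] tbig.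
have [sigma strat cut] := balance n n2n af.
exists sigma => // s ls fs ss; exists (size s) => //; rewrite take_size.
have nR : 0 < n%:R :> R by rewrite ltr0n.
pose E := avoider_edges af s.
have sK : [set:: s] \subset K_edges n.
  by apply/subsetP => e; rewrite in_set; case/andP: ls => _ /allP; apply.
have AG : subrel (adj E) (adj [set:: s]).
  by move=> a b; rewrite /adj !inE => /andP[-> /andP[-> _]].
have dens : 1 - r%:R^-1 + delta' <= density R (adj [set:: s]).
  rewrite /density card_adj // card_ord ler_pdivlMr ?exprn_gt0 //.
  have -> : #|[set:: s]| = size s.
    by case/andP: ls => /card_uniqP us _; rewrite -us cardsE.
  have le_delta : delta' <= delta by rewrite ge_min lexx.
  have le_r : delta' <= (2 * r%:R)^-1 by rewrite ge_min lexx orbT.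
  rewrite ss minnE; case: (leqP t.*2 #|K_edges n|) => le_t.
    rewrite (_ : _ - _ = t.*2)%N; last by lia.
    apply: le_trans (_ : _ <= 4 * t%:R) _; last first.
      by rewrite -mul2n mulnA natrM.
    by apply: le_trans tbig; apply: ler_wpM2r; [rewrite exprn_ge0 // ltW|rewrite lerD2l].
  rewrite (_ : _ - _ = #|K_edges n|)%N; last by lia.
  rewrite double_card_K_edges natrM -subn1 natrB // expr2.
  have : r%:R^-1 = 2 * (2 * r%:R)^-1 :> R by rewrite invfM mulrA mulfV ?mul1r ?pnatr_eq0.
  have : 1 <= n%:R * (2 * r%:R)^-1 :> R.
    by rewrite ler_pdivlMr ?mulr_gt0 // mul1r -natrM ler_nat.
  set q := (2 * r%:R)^-1 in le_r *; move=> nq ->.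
  have h := ler_wpM2r (ltW (mulr_gt0 nR nR)) le_r.
  have h2 := ler_wpM2l (ltW nR) nq.
  move: h h2; set N : R := n%:R; lra.
have [cn1 cn0] : (n1 <= #|'I_n|)%N /\ (0 < #|'I_n|)%N by rewrite card_ord.
have [f finj fE] := copy 'I_n (adj E) (adj [set:: s]) cn1 cn0
  (@adj_sym _ _) (@adj_irr _ _) (@adj_sym _ _) (@adj_irr _ _) AG dens (cut s ls fs).
apply/existsP; exists (f : {ffun H -> graph_of E}); apply/andP; split; first exact/injectiveP.
by apply/forallP => u; apply/forallP => w; rewrite /= fE.
Qed.

(** * Complete multipartite graphs and Turan numbers *)

(** The edge set of the complete multipartite graph with colour classes those of c. *)
Definition multipartite n (c : 'I_n -> nat) : {set {set 'I_n}} :=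
  [set e in K_edges n | [exists u in e, exists w in e, c u != c w]].

Lemma adj_multipartite n (c : 'I_n -> nat) u w : adj (multipartite c) u w = (c u != c w).
Proof.
rewrite /adj in_set set2_K_edges.
have [->|uw] := eqVneq u w; first by rewrite eqxx.
apply/andP/idP => [[_ /existsP[x /andP[xe /existsP[y /andP[ye xy]]]]]|cuw]; last first.
  split=> //; apply/existsP; exists u; rewrite set21 /=.
  by apply/existsP; exists w; rewrite set22.
by move: xe ye xy; rewrite !inE => /orP[]/eqP -> /orP[]/eqP ->; rewrite ?eqxx // eq_sym.
Qed.

Lemma multipartite_sub n (c : 'I_n -> nat) : multipartite c \subset K_edges n.
Proof. by apply/subsetP => e; rewrite in_set => /andP[]. Qed.

Lemma card_multipartite n (c : 'I_n -> nat) :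
  (2 * #|multipartite c| = #|ordered_edges (fun u w => c u != c w)|)%N.
Proof.
rewrite -card_adj ?multipartite_sub //.
by apply: eq_card => p; rewrite !inE adj_multipartite.
Qed.

Lemma colorable_hom (H G : sgraph) r (c : G -> nat) (f : H -> G) :
  (forall x, (c x < r)%N) ->
  (forall x y, sedge x y -> c (f x) != c (f y)) -> colorable H r.
Proof.
move=> cr fc; apply/existsP; exists [ffun x => Ordinal (cr (f x))].
apply/forallP => x; apply/forallP => y; apply/implyP => xy; rewrite !ffunE.
exact: fc.
Qed.

Lemma complete_graph_not_colorable r : ~~ colorable (complete_graph r.+1) r.
Proof.
apply/negP => /existsP[f /forallP fP].
have finj : injective f.
  move=> x y e; apply/eqP/negPn/negP => xy.
  by have /forallP/(_ y)/implyP/(_ xy) := fP x; rewrite e eqxx.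
by have := leq_card f finj; rewrite /= !card_ord ltnn.
Qed.

Lemma multipartite_copy_colorable (H : sgraph) n (c : 'I_n -> nat) r (E : {set {set 'I_n}}) :
  (forall x, (c x < r)%N) -> E \subset multipartite c ->
  has_copy H (graph_of E) -> colorable H r.
Proof.
move=> cr Ec /existsP[f /andP[_ /forallP fE]].
apply: (@colorable_hom H (graph_of E) r c f cr) => x y xy.
rewrite -adj_multipartite.
have /forallP/(_ y)/implyP/(_ xy) /andP[] := fE x.
by rewrite /adj => -> /(subsetP Ec) ->.
Qed.

Lemma multipartite_le_turan n (c : 'I_n -> nat) r : (forall x, (c x < r)%N) ->
  (#|multipartite c| <= turan n r)%N.
Proof.
move=> cr; rewrite /turan; apply: (leq_bigmax_cond (multipartite c)) => /=.
rewrite multipartite_sub; apply/negP.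
by move=> /(multipartite_copy_colorable cr (subxx _)); exact/negP/complete_graph_not_colorable.
Qed.

(** With [multipartite_le_turan], this says that the maximum in the definition of
    the Turan number is reached by a complete r-partite graph. *)
Lemma turan_multipartite n r : (0 < r)%N ->
  exists2 c : 'I_n -> nat, (forall x, (c x < r)%N) & (turan n r <= #|multipartite c|)%N.
Proof.
move=> r0.
have P0 : (set0 \subset K_edges n) &&
    ~~ has_copy (complete_graph r.+1) (graph_of (set0 : {set {set 'I_n}})).
  rewrite sub0set; apply/negP => /existsP[f /andP[_ /forallP/(_ ord0)/forallP/(_ ord_max)]].
  rewrite /= /adj in_set0 andbF implybF => /negP; apply.
  by rewrite /neq_rel -val_eqE /= eq_sym -lt0n.
rewrite /turan (bigop.bigmax_eq_arg set0) //; case: arg_maxnP => //= E /andP[EK noK] _.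
have [|c cr le_c] := @clique_free_le_multipartite _ (adj E) r (@adj_sym _ E).
  move=> s ss; apply: contra noK => spw; apply/existsP.
  have [x0 _] : exists x0, x0 \in s by case: s ss {spw} => // x s _; exists x; rewrite mem_head.
  have adj_nth (i j : 'I_r.+1) : i != j -> adj E (nth x0 s i) (nth x0 s j).
    move/(pairwiseP x0): spw => spw; rewrite -val_eqE neq_ltn.
    by case/orP=> ij; last rewrite adj_sym; apply: spw => //; rewrite inE ss ltn_ord.
  exists [ffun i : complete_graph r.+1 => nth x0 s i : graph_of E]; apply/andP; split.
    apply/injectiveP => i j; rewrite !ffunE => e; apply/eqP/negPn/negP => ij.
    by have := adj_nth i j ij; rewrite e adj_irr.
  by apply/forallP => i; apply/forallP => j; apply/implyP => ij; rewrite !ffunE; exact: adj_nth.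
exists c => //.
by rewrite -(leq_pmul2l (isT : 0 < 2)%N) card_multipartite -card_adj.
Qed.

(** * Bounds on the game *)

Lemma chi_colorable (G : sgraph) : colorable G (chi G).
Proof. by rewrite /chi; case: ex_minnP. Qed.

Lemma chi_min (G : sgraph) r : colorable G r -> (chi G <= r)%N.
Proof. by rewrite /chi; case: ex_minnP => m _; apply. Qed.

(** If t rounds involve fewer than turan n r moves, Avoider plays all his moves
    inside an extremal r-partite graph. *)
Lemma enforcer_needs_half_turan af (F : graph_family) n r t : (0 < r)%N ->
  (forall G, F G -> (r < chi G)%N) ->
  enforcer_wins_within af (contains F n) t -> ((turan n r)./2 <= t)%N.
Proof.
move=> r0 Fr [sigma strat win]; rewrite leqNgt; apply/negP => t_lt.
have [c cr turan_le] := turan_multipartite n r0.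
have tc : (t.*2 <= #|multipartite c|)%N.
  by apply: leq_trans turan_le; have := odd_double_half (turan n r); lia.
have cK := multipartite_sub c.
have [s [ls fs ss sE]] := avoider_stays_inside strat cK tc.
have [|i _ [H FH copyH]] := win s ls fs.
  by rewrite ss; apply/esym/minn_idPl; apply: leq_trans tc (subset_leq_card cK).
have := Fr H FH; rewrite ltnNge => /negP; apply; apply: chi_min.
apply: multipartite_copy_colorable copyH => //.
by apply/subsetP => e; exact: (avoider_edges_sub (P := mem (multipartite c)) sE).
Qed.

Lemma half_turan_estimate (R : realFieldType) n r : (0 < r)%N ->
  `|(1 - r%:R^-1) * (n%:R ^+ 2 / 4) - ((turan n r)./2)%:R| <= r.+1%:R :> R.
Proof.
move=> r0; have rR : 0 < r%:R :> R by rewrite ltr0n.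
have upper : (r * (2 * turan n r) + n ^ 2 <= r * n ^ 2)%N.
  have [c cr turan_le] := turan_multipartite n r0.
  have := multipartite_le cr; rewrite card_ord -card_multipartite; apply: leq_trans.
  by rewrite leq_add2r !leq_mul2l turan_le !orbT.
have lower : (r * n ^ 2 <= r * (2 * turan n r) + n ^ 2 + r ^ 2)%N.
  apply: leq_trans (balanced_multipartite_ge n r0) _.
  rewrite -card_multipartite !leq_add2r !leq_mul2l.
  by rewrite multipartite_le_turan ?orbT // => x; rewrite ltn_mod.
move: upper lower; set T := turan n r.
rewrite -!(ler_nat R) !natrD ![(r * _)%:R]natrM !natrX [(2 * T)%:R]natrM.
set N2 := n%:R ^+ 2 => upper lower.
have {}upper : 2 * T%:R <= (1 - r%:R^-1) * N2.
  rewrite -(ler_pM2l rR) [X in _ <= X]mulrA mulrBr mulr1 divff ?gt_eqF // mulrBl mul1r.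
  by rewrite lerBrDr.
have {}lower : (1 - r%:R^-1) * N2 <= 2 * T%:R + r%:R.
  rewrite -(ler_pM2l rR) mulrA mulrBr mulr1 divff ?gt_eqF // mulrBl mul1r mulrDr -expr2.
  by rewrite lerBlDr addrAC.
have T_half : T%:R = (odd T)%:R + 2 * (T./2)%:R :> R.
  by rewrite -natrM -natrD mul2n odd_double_half.
have odd_le : 0 <= ((odd T)%:R : R) <= 1 by exact: indicator_bounds.
have r1 : 1 <= r%:R :> R by rewrite ler1n.
rewrite -[r.+1%:R]natr1 mulrA ler_norml; move: upper lower T_half odd_le.
set h : R := (T./2)%:R; set X := (1 - _) * N2 => upper lower Th /andP[o0 o1].
by apply/andP; split; lra.
Qed.

(** The least winning number of rounds, and 0 when there is none. *)
Definition tauE af n (P : graph_property n) : nat :=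
  match pselect (exists t, `[< enforcer_wins_within af P t >]) with
  | left h => ex_minn h
  | right _ => 0
  end.

Lemma tauEP af n (P : graph_property n) t :
  enforcer_wins_within af P t -> is_tauE af P (tauE af P) /\ (tauE af P <= t)%N.
Proof.
move=> win; rewrite /tauE; case: pselect => [h|[]]; last by exists t; apply/asboolP.
case: ex_minnP => m /asboolP mwin mmin; split; last exact/mmin/asboolP.
by split=> // t' /asboolP; exact: mmin.
Qed.

Lemma contains_of_induced F n E : contains_induced F n E -> contains F n E.
Proof.
case=> H FH /existsP[f /andP[finj /forallP fE]]; exists H => //.
apply/existsP; exists f; rewrite finj; apply/forallP => x; apply/forallP => y.
by have /forallP/(_ y)/eqP -> := fE x; exact: implybb.
Qed.

(** The upper bound, in terms of r = k - 1. *)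
Lemma tauE_asymptotics (R : archiRealFieldType) (F : graph_family) r af :
  (0 < r)%N -> min_chromatic F r.+1 ->
  exists2 n0, (forall n, (n0 <= n)%N ->
     [/\ is_tauE af (contains F n) (tauE af (contains F n)),
         is_tauE af (contains_induced F n) (tauE af (contains_induced F n)) &
         (tauE af (contains F n) <= tauE af (contains_induced F n))%N]) &
  forall delta : R, 0 < delta -> exists n1, forall n, (n1 <= n)%N ->
    (tauE af (contains_induced F n))%:R <=
      (1 - r%:R^-1) * (n%:R ^+ 2 / 4) + delta * n%:R ^+ 2.
Proof.
move=> r0 [[H FH chiH] _].
have Hcol : colorable H r.+1 by rewrite -chiH chi_colorable.
have q1 : 0 <= 1 - r%:R^-1 :> R by rewrite subr_ge0 invf_le1 ?ler1n ?ltr0n.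
have wins (delta : R) : 0 < delta -> exists n1, forall n, (n1 <= n)%N ->
    exists2 t, enforcer_wins_within af (contains_induced F n) t &
    t%:R <= (1 - r%:R^-1) * (n%:R ^+ 2 / 4) + delta * n%:R ^+ 2.
  move=> d0; have [n1 win] := enforcer_forces_induced_copy af r0 Hcol d0.
  exists (maxn n1 (Num.bound (2 / delta)).+1) => n; rewrite geq_max => /andP[n1n nbig].
  set X := (1 - r%:R^-1) * (n%:R ^+ 2 / 4) + delta * n%:R ^+ 2.
  have X0 : 0 <= X by rewrite addr_ge0 // mulr_ge0 ?divr_ge0 ?exprn_ge0 // ltW.
  exists (Num.truncn X); last by rewrite truncn_le.
  (* rounding to an integer costs less than delta n^2 *)
  have nd : 2 <= delta * n%:R.
    rewrite mulrC -ler_pdivrMr //; apply: le_trans (ltW (archi_boundP _)) _.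
      by rewrite divr_ge0 // ltW.
    by rewrite ler_nat ltnW.
  have n1R : 1 <= n%:R :> R by rewrite ler1n; apply: leq_ltn_trans nbig.
  have Xlt : X < (Num.truncn X)%:R + 1 by rewrite natr1 truncnS_gt.
  have dn2 : 2 <= delta * n%:R ^+ 2.
    apply: le_trans nd _; rewrite expr2 mulrA ler_peMr //.
    by rewrite mulr_ge0 // ltW.
  have big : (1 - r%:R^-1 + delta) * n%:R ^+ 2 <= 4 * (Num.truncn X)%:R.
    move: Xlt dn2; rewrite {1}/X; set t : R := (Num.truncn X)%:R.
    by move: (1 - _ : R) (n%:R ^+ 2 : R) => q N2; lra.
  have [sigma strat s_win] := win n (Num.truncn X) n1n big.
  exists sigma => // s ls fs ss; have [i si copy] := s_win s ls fs ss.
  by exists i => //; exists H.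
have [n0 win1] := wins 1 ltr01.
exists n0 => [n n0n|delta d0].
  have [t win _] := win1 n n0n.
  have [tau_ind _] := tauEP win; have := tau_ind.1.
  move=> /(wins_within_sub (@contains_of_induced F n)) /tauEP[tau le_tau].
  by split.
have [n1 win] := wins delta d0; exists n1 => n n1n.
have [t wt tle] := win n n1n; have [_ tau_le] := tauEP wt.
by apply: le_trans tle; rewrite ler_nat.
Qed.

Theorem theorem2 (R : realType) :
  exists C : R, forall (F : graph_family) (k : nat) (af : bool),
  min_chromatic F k ->
  ((3 <= k)%N ->
    exists (n0 : nat) (tau tau_ind : nat -> nat),
      (forall n : nat, (n0 <= n)%N ->
        [/\ is_tauE af (contains F n) (tau n),
            is_tauE af (contains_induced F n) (tau_ind n),
            `| (k%:R - 2) / (k%:R - 1) * (n%:R ^+ 2 / 4)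
               - ((turan n (k - 1))./2)%:R | <= C * k%:R,
            ((turan n (k - 1))./2 <= tau n)%N
          & (tau n <= tau_ind n)%N]) /\
      (forall delta : R, 0 < delta ->
        exists n1 : nat, forall n : nat, (n1 <= n)%N ->
          (tau_ind n)%:R <= (k%:R - 2) / (k%:R - 1) * (n%:R ^+ 2 / 4)
                            + delta * n%:R ^+ 2)) /\
  (k = 2%N ->
    exists (n0 : nat) (tau tau_ind : nat -> nat),
      (forall n : nat, (n0 <= n)%N ->
        [/\ is_tauE af (contains F n) (tau n),
            is_tauE af (contains_induced F n) (tau_ind n)
          & (tau n <= tau_ind n)%N]) /\
      (forall delta : R, 0 < delta ->
        exists n1 : nat, forall n : nat, (n1 <= n)%N ->
          (tau_ind n)%:R <= (k%:R - 2) / (k%:R - 1) * (n%:R ^+ 2 / 4)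
                            + delta * n%:R ^+ 2 /\
          (tau_ind n)%:R <= delta * n%:R ^+ 2)).
Proof.
exists 1 => F k af minF.
have coef r : (0 < r)%N -> (r.+1%:R - 2) / (r.+1%:R - 1) = 1 - r%:R^-1 :> R.
  move=> r0; have rR : r%:R != 0 :> R by rewrite pnatr_eq0 -lt0n.
  by rewrite -natr1; field.
split=> [k3|k2].
  case: k k3 minF => // r r2 minF; have r0 : (0 < r)%N by exact: ltnW.
  have [n0 tau_ok tau_le] := @tauE_asymptotics R F r af r0 minF.
  exists n0, (fun n => tauE af (contains F n)), (fun n => tauE af (contains_induced F n)).
  rewrite subn1 /= coef //; split=> // n n0n; have [tau tau_ind le_tau] := tau_ok n n0n.
  split=> //; first by rewrite mul1r; exact: half_turan_estimate.
  by apply: enforcer_needs_half_turan r0 minF.2 tau.1.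
subst k; have [n0 tau_ok tau_le] := @tauE_asymptotics R F 1 af isT minF.
exists n0, (fun n => tauE af (contains F n)), (fun n => tauE af (contains_induced F n)).
split=> // delta d0; have [n1 le1] := tau_le delta d0; exists n1 => n n1n.
rewrite coef //; split; first exact: le1.
by apply: le_trans (le1 n n1n) _; rewrite invr1 subrr mul0r add0r.
Qed.
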